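(* For the heavy-tailed linear bandit problem in the context, run the algorithm Heavy-OFUL described there with $$c_0=\frac{1}{\sqrt{23\log\frac{2T^2}{\delta}}},\quad c_1=\frac{(\log 3T)^{\frac{1-\epsilon}{1+\epsilon}}}{48\left(\log\frac{2T^2}{\delta}\right)^{\frac{2}{1+\epsilon}}},\quad \tau_0=\frac{\sqrt{2\kappa}\,(\log 3T)^{\frac{1-\epsilon}{2(1+\epsilon)}}}{\left(\log\frac{2T^2}{\delta}\right)^{\frac{1}{1+\epsilon}}},$$ $$\beta_t=3\sqrt{\lambda}B+24\,t^{\frac{1-\epsilon}{2(1+\epsilon)}}\sqrt{2\kappa}\,(\log 3T)^{\frac{1-\epsilon}{2(1+\epsilon)}}\left(\log\frac{2T^2}{\delta}\right)^{\frac{\epsilon}{1+\epsilon}},$$ $\lambda=d/B^2$ and $\sigma_{\min}=1/\sqrt T$. Then with probability at least $1-3\delta$, the regret of Heavy-OFUL satisfies $$\mathrm{Regret}(T)=\tilde O\left(d\,T^{\frac{1-\epsilon}{2(1+\epsilon)}}\sqrt{\sum_{t=1}^T\nu_t^2}+d\,T^{\frac{1-\epsilon}{2(1+\epsilon)}}\right).$$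
   Context: Notation: $\|x\|_A=\sqrt{x^\top Ax}$; $\mathcal B_d(r)=\{x\in\mathbb R^d:\|x\|_2\le r\}$. $\tilde O(\cdot)$ hides absolute constants and polylogarithmic factors in the problem parameters and $1/\delta$; the known bounds $L,B$ are treated as constants. Heavy-tailed linear bandits. Fix $\epsilon\in(0,1]$. Let $(\mathcal D_t)_{t\ge1}$ be fixed decision sets in $\mathbb R^d$, all of whose elements have Euclidean norm at most a known $L$. At round $t$ the agent chooses $\phi_t\in\mathcal D_t$ and receives $R_t=\langle\phi_t,\theta^*\rangle+\varepsilon_t$, with unknown $\theta^*\in\mathcal B_d(B)$, $B$ known. Let $\mathcal F_t=\sigma(\{\phi_s,R_s\}_{s\in[t]}\cup\{\phi_{t+1}\})$. The noise $\varepsilon_t$ is $\mathcal F_t$-measurable with $\mathbb E[\varepsilon_t|\mathcal F_{t-1}]=0$, $\mathbb E[|\varepsilon_t|^{1+\epsilon}|\mathcal F_{t-1}]=\nu_t^{1+\epsilon}$, with $\nu_t$ being $\mathcal F_{t-1}$-measurable. The pseudo-regret is $\mathrm{Regret}(T)=\sum_{t=1}^T[\langle\phi_t^*,\theta^*\rangle-\langle\phi_t,\theta^*\rangle]$ with $\phi_t^*=\operatorname{argmax}_{\phi\in\mathcal D_t}\langle\phi,\theta^*\rangle$. Huber loss: for $\tau>0$, $\ell_\tau(x)=x^2/2$ if $|x|\le\tau$ and $\ell_\tau(x)=\tau|x|-\tau^2/2$ otherwise. Heavy-OFUL. Inputs: $T$, $\delta\in(0,1)$, $\lambda,\sigma_{\min},c_0,c_1,\tau_0,(\beta_t)$.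 Set $\kappa=d\log\left(1+\frac{TL^2}{d\lambda\sigma_{\min}^2}\right)$, $\mathcal C_0=\mathcal B_d(B)$, $H_0=\lambda I$. For $t=1,\dots,T$: observe $\mathcal D_t$; let $\phi_t$ be the first component of a maximizer of $\langle\phi,\theta\rangle$ over $\phi\in\mathcal D_t,\theta\in\mathcal C_{t-1}$; play $\phi_t$ and observe $R_t$ and $\nu_t$; set $$\sigma_t=\max\left\{\nu_t,\sigma_{\min},\frac{\|\phi_t\|_{H_{t-1}^{-1}}}{c_0},\frac{\sqrt{LB}}{c_1^{1/4}(2\kappa)^{1/4}}\|\phi_t\|_{H_{t-1}^{-1}}^{1/2}\right\},$$ $w_t=\|\phi_t/\sigma_t\|_{H_{t-1}^{-1}}$, $\tau_t=\tau_0\frac{\sqrt{1+w_t^2}}{w_t}t^{\frac{1-\epsilon}{2(1+\epsilon)}}$ (with $\tau_t=+\infty$, i.e. squared loss, if $w_t=0$), $H_t=H_{t-1}+\sigma_t^{-2}\phi_t\phi_t^\top$, $$\theta_t=\operatorname*{argmin}_{\theta\in\mathcal B_d(B)}\left\{\frac\lambda2\|\theta\|_2^2+\sum_{s=1}^t\ell_{\tau_s}\left(\frac{R_s-\langle\phi_s,\theta\rangle}{\sigma_s}\right)\right\},\qquad \mathcal C_t=\{\theta\in\mathbb R^d:\|\theta-\theta_t\|_{H_t}\le\beta_t\}.$$ *)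

(* Defs.v *)
From HB Require Import structures.
From mathcomp Require Import all_boot all_order all_algebra.
From mathcomp Require Import all_classical all_reals all_analysis.

Set Implicit Arguments.
Unset Strict Implicit.
Unset Printing Implicit Defensive.

Import Order.TTheory GRing.Theory Num.Theory.
Import numFieldNormedType.Exports.

Local Open Scope classical_set_scope.
Local Open Scope ring_scope.

Definition dot (R : realType) (d : nat) (x y : 'cV[R]_d) : R :=
  (x^T *m y) 0 0.

(* The norm of the library on matrices is the sup norm. *)
Definition norm2 (R : realType) (d : nat) (x : 'cV[R]_d) : R :=
  Num.sqrt (dot x x).

Definition wnorm (R : realType) (d : nat) (A : 'M[R]_d) (x : 'cV[R]_d) : R :=
  Num.sqrt ((x^T *m A *m x) 0 0).

Definition eball (R : realType) (d : nat) (r : R) : set 'cV[R]_d :=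
  [set x | norm2 x <= r].

Definition is_maximizer (R : realType) (U : Type) (A : set U) (f : U -> R)
  (x : U) : Prop := A x /\ forall y, A y -> f y <= f x.

Definition is_minimizer (R : realType) (U : Type) (A : set U) (f : U -> R)
  (x : U) : Prop := A x /\ forall y, A y -> f x <= f y.

(* The threshold [+oo] gives the squared loss. *)
Definition huber (R : realType) (tau : \bar R) (x : R) : R :=
  if (`|x|%:E <= tau)%E then x ^+ 2 / 2
  else fine tau * `|x| - fine tau ^+ 2 / 2.

(* Measurability with respect to the sigma-algebra generated by [G]. *)
Definition measurable_wrt (R : realType) (Omega : pointedType)
  (G : set (set Omega)) (f : Omega -> R) : Prop :=
  measurable_fun [set: g_sigma_algebraType G] (f : g_sigma_algebraType G -> R).

(* [Y] is a version of the conditional expectation of [X] given the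
   sigma-algebra generated by [G]. As usual, it makes sense when [X] is
   integrable or when [X] is nonnegative (and then [X] need not be integrable:
   the defining integrals are extended real numbers). *)
Definition is_cond_expectation (R : realType) (disp : measure_display)
  (Omega : measurableType disp) (P : probability Omega R)
  (G : set (set Omega)) (X Y : Omega -> R) : Prop :=
  [/\ P.-integrable [set: Omega] (EFin \o X)
        \/ measurable_fun [set: Omega] X /\ (forall w, 0 <= X w),
      measurable_wrt G Y
    & forall A, <<s G >> A ->
        (\int[P]_(w in A) (Y w)%:E = \int[P]_(w in A) (X w)%:E)%E].

(* Generators of F_t, the sigma-algebra of the arms phi_1, .., phi_(t+1) (given
   by their coordinates) and of the rewards R_1, .., R_t. Rounds are numbered
   from 1: index 0 of the processes is not used. *)
Definition history (R : realType) (d : nat) (disp : measure_display)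
  (Omega : measurableType disp) (phi : nat -> Omega -> 'cV[R]_d)
  (rew : nat -> Omega -> R) (t : nat) : set (set Omega) :=
  (\bigcup_(s in [set s | (1 <= s <= t.+1)%N]) \bigcup_(i in [set: 'I_d])
     preimage_set_system setT (fun w => phi s w i 0) measurable)
  `|`
  (\bigcup_(s in [set s | (1 <= s <= t)%N])
     preimage_set_system setT (rew s) measurable).

(* Interaction over the rounds 1, .., T. *)
Record heavy_tailed_bandit (R : realType) (d T : nat) (L B eps : R)
  (D : nat -> set 'cV[R]_d) (theta_star : 'cV[R]_d)
  (disp : measure_display) (Omega : measurableType disp)
  (P : probability Omega R) (phi : nat -> Omega -> 'cV[R]_d)
  (rew noise nu : nat -> Omega -> R) : Prop := HeavyTailedBandit {
  arms_bounded : forall t, (1 <= t <= T)%N -> D t `<=` eball L;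
  param_bounded : eball B theta_star;
  arm_measurable : forall t, (1 <= t <= T)%N ->
    forall i, measurable_fun [set: Omega] (fun w => phi t w i 0);
  reward_measurable : forall t, (1 <= t <= T)%N ->
    measurable_fun [set: Omega] (rew t);
  arm_chosen : forall t, (1 <= t <= T)%N -> forall w, D t (phi t w);
  reward_eq : forall t, (1 <= t <= T)%N ->
    forall w, rew t w = dot (phi t w) theta_star + noise t w;
  noise_adapted : forall t, (1 <= t <= T)%N ->
    measurable_wrt (history phi rew t) (noise t);
  noise_centered : forall t, (1 <= t <= T)%N ->
    is_cond_expectation P (history phi rew t.-1) (noise t) (fun=> 0);
  nu_ge0 : forall t, (1 <= t <= T)%N -> forall w, 0 <= nu t w;
  nu_predictable : forall t, (1 <= t <= T)%N ->
    measurable_wrt (history phi rew t.-1) (nu t);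
  noise_moment : forall t, (1 <= t <= T)%N ->
    is_cond_expectation P (history phi rew t.-1)
      (fun w => `|noise t w| `^ (1 + eps)) (fun w => nu t w `^ (1 + eps)) }.

Definition regret (R : realType) (d T : nat) (theta_star : 'cV[R]_d)
  (phi_star phi : nat -> 'cV[R]_d) : R :=
  \sum_(1 <= t < T.+1) (dot (phi_star t) theta_star - dot (phi t) theta_star).

Record hoful_input (R : realType) := HofulInput {
  horizon : nat;
  arm_bound : R;
  param_bound : R;
  lambda : R;
  sigma_min : R;
  c0 : R;
  c1 : R;
  tau0 : R;
  beta : nat -> R }.

Definition kappa_of (R : realType) (d T : nat) (L lam smin : R) : R :=
  d%:R * ln (1 + T%:R * L ^+ 2 / (d%:R * lam * smin ^+ 2)).

Definition kappa (R : realType) (d : nat) (I : hoful_input R) : R :=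
  kappa_of d (horizon I) (arm_bound I) (lambda I) (sigma_min I).

(* sigma_t as a function of H_(t-1), phi_t and nu_t *)
Definition sigma_step (R : realType) (d : nat) (I : hoful_input R)
  (H : 'M[R]_d) (x : 'cV[R]_d) (v : R) : R :=
  Num.max v (Num.max (sigma_min I) (Num.max
    (wnorm (invmx H) x / c0 I)
    (Num.sqrt (arm_bound I * param_bound I)
       / (c1 I `^ 4^-1 * (2 * kappa d I) `^ 4^-1)
     * Num.sqrt (wnorm (invmx H) x)))).

Fixpoint Hmat (R : realType) (d : nat) (I : hoful_input R)
  (phi : nat -> 'cV[R]_d) (nu : nat -> R) (t : nat) : 'M[R]_d :=
  match t with
  | 0%N => (lambda I)%:M
  | t'.+1 =>
      let H := Hmat I phi nu t' in
      H + (sigma_step I H (phi t) (nu t)) ^- 2 *: (phi t *m (phi t)^T)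
  end.

Definition sigma (R : realType) (d : nat) (I : hoful_input R)
  (phi : nat -> 'cV[R]_d) (nu : nat -> R) (t : nat) : R :=
  sigma_step I (Hmat I phi nu t.-1) (phi t) (nu t).

Definition weight (R : realType) (d : nat) (I : hoful_input R)
  (phi : nat -> 'cV[R]_d) (nu : nat -> R) (t : nat) : R :=
  wnorm (invmx (Hmat I phi nu t.-1)) ((sigma I phi nu t)^-1 *: phi t).

Definition tau (R : realType) (d : nat) (eps : R) (I : hoful_input R)
  (phi : nat -> 'cV[R]_d) (nu : nat -> R) (t : nat) : \bar R :=
  let w := weight I phi nu t in
  if w == 0 then +oo%E
  else (tau0 I * (Num.sqrt (1 + w ^+ 2) / w)
        * t%:R `^ ((1 - eps) / (2 * (1 + eps))))%:E.

Definition hoful_loss (R : realType) (d : nat) (eps : R) (I : hoful_input R)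
  (phi : nat -> 'cV[R]_d) (rew nu : nat -> R) (t : nat) (th : 'cV[R]_d) : R :=
  lambda I / 2 * norm2 th ^+ 2
  + \sum_(1 <= s < t.+1)
      huber (tau eps I phi nu s)
        ((rew s - dot (phi s) th) / sigma I phi nu s).

Definition conf_set (R : realType) (d : nat) (I : hoful_input R)
  (phi : nat -> 'cV[R]_d) (nu : nat -> R) (theta : nat -> 'cV[R]_d)
  (t : nat) : set 'cV[R]_d :=
  if t == 0%N then eball (param_bound I)
  else [set th | wnorm (Hmat I phi nu t) (th - theta t) <= beta I t].

(* The sample path [(phi, rew, nu)], with estimates [theta], is produced by
   Heavy-OFUL; ties between maximizers may be broken in any way. *)
Record heavy_oful_run (R : realType) (d : nat) (eps : R) (I : hoful_input R)
  (D : nat -> set 'cV[R]_d) (phi : nat -> 'cV[R]_d) (rew nu : nat -> R)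
  (theta : nat -> 'cV[R]_d) : Prop := HeavyOfulRun {
  optimistic_choice : forall t, (1 <= t <= horizon I)%N -> exists th,
    is_maximizer (D t `*` conf_set I phi nu theta t.-1)
      (fun p => dot p.1 p.2) (phi t, th);
  huber_estimate : forall t, (1 <= t <= horizon I)%N ->
    is_minimizer (eball (param_bound I)) (hoful_loss eps I phi rew nu t)
      (theta t) }.

Definition tuned_input (R : realType) (d T : nat) (L B eps delta : R) :
    hoful_input R :=
  let lam := d%:R / B ^+ 2 in
  let smin := 1 / Num.sqrt T%:R in
  let kap := kappa_of d T L lam smin in
  let lg := ln (2 * T%:R ^+ 2 / delta) in
  let l3 := ln (3 * T%:R) in
  {| horizon := T;
     arm_bound := L;
     param_bound := B;
     lambda := lam;
     sigma_min := smin;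
     c0 := 1 / Num.sqrt (23 * lg);
     c1 := l3 `^ ((1 - eps) / (1 + eps)) / (48 * lg `^ (2 / (1 + eps)));
     tau0 := Num.sqrt (2 * kap) * l3 `^ ((1 - eps) / (2 * (1 + eps)))
             / lg `^ (1 / (1 + eps));
     beta := fun t => 3 * Num.sqrt lam * B
       + 24 * t%:R `^ ((1 - eps) / (2 * (1 + eps))) * Num.sqrt (2 * kap)
         * l3 `^ ((1 - eps) / (2 * (1 + eps))) * lg `^ (eps / (1 + eps)) |}.

(* The quantity whose fixed powers are hidden by the soft-O; it is at least 1
   for d, T >= 1 and 0 < delta < 1. *)
Definition log_factor (R : realType) (d T : nat) (delta : R) : R :=
  1 + ln d%:R + ln T%:R + ln delta^-1.

(* Main.v *)
(* Write x_s = phi_s / sigma_s, let z_s be the normalized noise divided by the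
   Huber threshold tau_s, and let S_t = sum_s tau_s clip(z_s) x_s, which is minus
   the gradient at theta_star of the sum of the Huber losses.

   Since |z|^(1+eps) dominates both clip(z)^2 and the bias |z - clip(z)|, one has
   exp(v clip(z)) <= 1 + v z + 2 |z|^(1+eps) for |v| <= 1 and
   exp(clip(z)^2) <= 1 + 2 |z|^(1+eps). As the conditional moments of |z_s|^(1+eps)
   sum to at most l = log(2 T^2 / delta), by Hoelder's inequality and the
   elliptical potential bound, exponential supermartingales show that
   sum_s clip(z_s)^2 <= 3 l and, for every t, that a predictable weighted sum of
   the clip(z_s) is at most 3 l. These two events suffice:
   - by the Sherman-Morrison formula, the H_t^{-1}-norm of S_t grows by terms that
     the two events control, so it stays below a multiple of tau_0 t^a l, where
     a = (1 - eps) / (2 (1 + eps));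
   - a round with |z_s| > 2/3 has clip(z_s)^2 > 4/9, so there are few of them, and
     since w_s <= c_0 they carry at most a third of H_t; in the other rounds the
     Huber loss is quadratic on the whole range of residuals.
   Hence theta_star stays in all confidence sets, and optimism bounds the regret
   by 2 beta_T sum_t |phi_t|_{H_{t-1}^{-1}}, which the definition of sigma_t and
   the elliptical potential bound control. *)
Require Import Defs.
From HB Require Import structures.
From mathcomp Require Import all_boot all_order all_algebra.
From mathcomp Require Import all_classical all_reals all_analysis.
From mathcomp Require Import measurable_realfun.
From mathcomp Require Import ring lra.

Set Implicit Arguments.
Unset Strict Implicit.
Unset Printing Implicit Defensive.

Import Order.TTheory GRing.Theory Num.Theory.
Import numFieldNormedType.Exports.

Local Open Scope classical_set_scope.
Local Open Scope ring_scope.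

(** * Positive definite matrices *)

(** The linear term of the norm recursion involves the direction of the earlier score sums, which is
    small only where the bound to be proved already holds. It is therefore truncated at the level of
    that bound ([score_coef]): the truncated weights are bounded on every path, so the concentration
    inequality applies to them without any condition, and on the resulting event an induction on t
    shows that the truncation never acts. The level depends on t, hence one event for each t,
    besides the one for the squares; each of these T + 1 events fails with probability at most exp(-
    l) = delta / (2 T^2).

    Nothing bounds nu_s, so the unconditional moment of order 1 + eps of the noise may be infinite.
    Only the noise divided by sigma_s >= nu_s is used: its conditional moment is at most 1, so the
    compensator of round s is the power 1 + eps of [inv_tau s], which is predictable and bounded by
    a constant. *)

Definition qform (R : realType) (d : nat) (A : 'M[R]_d) (x : 'cV[R]_d) : R :=
  (x^T *m A *m x) 0 0.

Definition posdef (R : realType) (d : nat) (A : 'M[R]_d) : Prop :=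
  A^T = A /\ forall x, x != 0 -> 0 < qform A x.

Section DotProduct.
Variables (R : realType) (d : nat).
Implicit Types (x y z : 'cV[R]_d) (A : 'M[R]_d).

Lemma mx11_tr (M : 'M[R]_1) : M^T = M.
Proof. by apply/matrixP => i j; rewrite mxE !ord1. Qed.

Lemma dotC x y : dot x y = dot y x.
Proof. by rewrite /dot -[in LHS](mx11_tr (_ *m _)) trmx_mul trmxK. Qed.

Lemma dotDl x y z : dot (x + y) z = dot x z + dot y z.
Proof. by rewrite /dot linearD mulmxDl mxE. Qed.

Lemma dotDr x y z : dot x (y + z) = dot x y + dot x z.
Proof. by rewrite /dot mulmxDr mxE. Qed.

Lemma dotNl x y : dot (- x) y = - dot x y.
Proof. by rewrite /dot linearN mulNmx mxE. Qed.

Lemma dotNr x y : dot x (- y) = - dot x y.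
Proof. by rewrite /dot mulmxN mxE. Qed.

Lemma dotBr x y z : dot x (y - z) = dot x y - dot x z.
Proof. by rewrite dotDr dotNr. Qed.

Lemma dotZl a x y : dot (a *: x) y = a * dot x y.
Proof. by rewrite /dot linearZ -scalemxAl mxE. Qed.

Lemma dotZr a x y : dot x (a *: y) = a * dot x y.
Proof. by rewrite dotC dotZl dotC. Qed.

Lemma dot0l x : dot 0 x = 0.
Proof. by rewrite /dot trmx0 mul0mx mxE. Qed.

Lemma dot_suml (J : Type) (r : seq J) (P : pred J) (F : J -> 'cV[R]_d) y :
  dot (\sum_(i <- r | P i) F i) y = \sum_(i <- r | P i) dot (F i) y.
Proof.
elim: r => [|j r IH]; first by rewrite !big_nil /dot trmx0 mul0mx mxE.
by rewrite !big_cons; case: ifP => // _; rewrite dotDl IH.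
Qed.

Lemma dotE x y : dot x y = \sum_i x i 0 * y i 0.
Proof. by rewrite /dot mxE; apply: eq_bigr => i _; rewrite mxE. Qed.

Lemma dot_ge0 x : 0 <= dot x x.
Proof. by rewrite dotE sumr_ge0 // => i _; rewrite -expr2 sqr_ge0. Qed.

Lemma dot_eq0 x : (dot x x == 0) = (x == 0).
Proof.
apply/idP/eqP => [|->]; last by rewrite dot0l.
rewrite dotE psumr_eq0 => [/allP x0|i _]; last by rewrite -expr2 sqr_ge0.
apply/colP => i; have /implyP /(_ isT) := x0 i (mem_index_enum i).
by rewrite mulf_eq0 orbb mxE => /eqP.
Qed.

Lemma qformE A x : qform A x = dot x (A *m x).
Proof. by rewrite /qform /dot mulmxA. Qed.

Lemma dot_mulmxl A x y : dot (A *m x) y = dot x (A^T *m y).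
Proof. by rewrite /dot trmx_mul mulmxA. Qed.

Lemma mul_dot x y : x *m (x^T *m y) = dot x y *: x.
Proof.
by rewrite [x^T *m y]mx11_scalar mul_mx_scalar.
Qed.

Lemma wnorm_sqr A x : 0 <= qform A x -> wnorm A x ^+ 2 = qform A x.
Proof. exact: sqr_sqrtr. Qed.

Lemma wnorm_ge0 A x : 0 <= wnorm A x.
Proof. exact: sqrtr_ge0. Qed.

Lemma norm2_sqr x : norm2 x ^+ 2 = dot x x.
Proof. by rewrite /norm2 sqr_sqrtr // dot_ge0. Qed.

Lemma norm2_ge0 x : 0 <= norm2 x.
Proof. exact: sqrtr_ge0. Qed.

End DotProduct.

Section PositiveDefinite.
Variables (R : realType) (d : nat).
Implicit Types (x y z S : 'cV[R]_d) (A H : 'M[R]_d).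

Lemma posdef_qform_ge0 A x : posdef A -> 0 <= qform A x.
Proof.
move=> [_ A0]; have [->|/A0/ltW//] := eqVneq x 0.
by rewrite /qform mulmx0 mxE.
Qed.

Lemma posdef_unit A : posdef A -> A \in unitmx.
Proof.
move=> [As A0]; rewrite -row_free_unit -kermx_eq0.
apply/rowV0P => v /sub_kermxP vA0; apply/eqP; apply: contraTT isT => v0.
have /A0 : v^T != 0 by apply: contra_neq v0 => /(congr1 trmx); rewrite trmxK trmx0.
by rewrite /qform trmxK vA0 mul0mx mxE ltxx.
Qed.

Lemma posdef_inv A : posdef A -> posdef (invmx A).
Proof.
move=> pA; have uA := posdef_unit pA; case: (pA) => As A0; split.
  by rewrite trmx_inv As.
move=> x x0; set y := invmx A *m x.
have xE : x = A *m y by rewrite /y mulKVmx.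
have y0 : y != 0 by apply: contra_neq x0 => y0; rewrite xE y0 mulmx0.
have := A0 _ y0; congr (_ < _).
by rewrite !qformE -/y -xE dotC.
Qed.

Lemma posdef_scalar a : 0 < a -> posdef (a%:M : 'M[R]_d).
Proof.
move=> a0; split=> [|x x0]; first by rewrite tr_scalar_mx.
rewrite qformE mul_scalar_mx dotZr mulr_gt0 // lt_neqAle dot_ge0 andbT.
by rewrite eq_sym dot_eq0.
Qed.

Lemma qform_rank1 x y : qform (x *m x^T) y = dot x y ^+ 2.
Proof.
by rewrite qformE -mulmxA mul_dot dotZr dotC expr2.
Qed.

Lemma qformD A H x : qform (A + H) x = qform A x + qform H x.
Proof. by rewrite !qformE mulmxDl dotDr. Qed.

Lemma qform_scalar a x : qform a%:M x = a * dot x x.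
Proof. by rewrite qformE mul_scalar_mx dotZr. Qed.

Lemma qformZ a A x : qform A (a *: x) = a ^+ 2 * qform A x.
Proof. by rewrite !qformE -scalemxAr dotZr dotZl mulrA. Qed.

Lemma posdef_rank1 H x : posdef H -> posdef (H + x *m x^T).
Proof.
move=> pH; case: (pH) => Hs H0; split=> [|y y0].
  by rewrite linearD /= trmx_mul trmxK Hs.
by rewrite qformD qform_rank1 ltr_pwDl ?H0 // sqr_ge0.
Qed.

(** The form [H] is nonnegative at the residual of the [H]-orthogonal projection of H^-1 x onto y;
    the inner product of H^-1 x and y in the form [H] is [dot x y]. *)
Lemma CauchySchwarz_posdef H x y : posdef H ->
  dot x y ^+ 2 <= qform (invmx H) x * qform H y.
Proof.
move=> pH; have uH := posdef_unit pH; case: (pH) => Hs H0.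
have [->|y0] := eqVneq y 0; first by rewrite [qform H 0]qformE mulmx0 dotC !dot0l expr0n mulr0.
have q0 := H0 _ y0.
set r := dot x y; set u := invmx H *m x.
have := posdef_qform_ge0 (u - (r / qform H y) *: y) pH.
have Hu : H *m u = x by rewrite /u mulKVmx.
have qi : qform (invmx H) x = dot u x by rewrite qformE dotC.
rewrite qformE mulmxBr Hu -scalemxAr !dotDl !dotBr !dotNl !dotZl !dotZr.
have -> : dot u (H *m y) = r by rewrite dotC dot_mulmxl Hs Hu dotC.
rewrite -qi -qformE ![dot y x]dotC -/r; set q := qform H y; set p := qform _ x.
have q0' : 0 < q by [].
move=> /(mulr_ge0 (ltW q0')); rewrite (_ : q * _ = p * q - r ^+ 2) ?subr_ge0 //.
by field; rewrite gt_eqF.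
Qed.

Lemma dot_le_wnorm H x y : posdef H ->
  `|dot x y| <= wnorm (invmx H) x * wnorm H y.
Proof.
move=> pH; rewrite -ler_sqr ?nnegrE ?mulr_ge0 ?wnorm_ge0 // -normrX (ger0_norm (sqr_ge0 _)).
rewrite exprMn !wnorm_sqr ?posdef_qform_ge0 ?CauchySchwarz_posdef //.
exact: posdef_inv.
Qed.

Lemma dot_le_norm2 x y : `|dot x y| <= norm2 x * norm2 y.
Proof.
have p1 : posdef (1%:M : 'M[R]_d) := posdef_scalar ltr01.
have := dot_le_wnorm x y p1.
by rewrite invmx1 /wnorm -!/(qform _ _) !qform_scalar !mul1r.
Qed.

(** Put u = H^-1 x and q = x . u, which is also the form [H] at u. Then q^2 <= |x|^2 |u|^2 <= |x|^2
    q / lam, and one factor q cancels. *)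
Lemma qform_inv_le H lam x : posdef H -> 0 < lam ->
  (forall y, lam * dot y y <= qform H y) -> qform (invmx H) x <= dot x x / lam.
Proof.
move=> pH lam0 lamH; have uH := posdef_unit pH.
set u := invmx H *m x; set q := qform _ x.
have q0 : 0 <= q by apply/posdef_qform_ge0/posdef_inv.
have qE : q = dot x u by rewrite /q qformE.
have qH : qform H u = q by rewrite qformE /u mulKVmx // dotC qE.
have := lamH u; rewrite qH => hu.
rewrite ler_pdivlMr //.
have := dot_le_norm2 x u; rewrite -qE ger0_norm // => qle.
have : q ^+ 2 <= dot x x * dot u u.
  by rewrite -!norm2_sqr -exprMn ler_sqr ?nnegrE // mulr_ge0 // norm2_ge0.
move=> q2.
have : q * (q * lam) <= q * dot x x.
  rewrite mulrA -expr2 (le_trans (ler_wpM2r (ltW lam0) q2)) //.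
  by rewrite -mulrA [leRHS]mulrC ler_wpM2l ?dot_ge0 // mulrC.
have [->|qn0] := eqVneq q 0; first by rewrite !mul0r => _; exact: dot_ge0.
by rewrite ler_pM2l // lt_neqAle eq_sym qn0.
Qed.

Lemma sherman_morrison H x : posdef H ->
  invmx (H + x *m x^T)
  = invmx H - (1 + qform (invmx H) x)^-1 *: (invmx H *m x *m (invmx H *m x)^T).
Proof.
move=> pH; have uH := posdef_unit pH; case: (pH) => Hs _.
have uH' := posdef_unit (posdef_rank1 x pH).
set w := qform _ x; set u := invmx H *m x.
have w0 : 0 <= w by apply/posdef_qform_ge0/posdef_inv.
apply: (can_inj (mulKmx uH')); rewrite mulmxV //; apply/esym.
have Hu : H *m u = x by rewrite /u mulKVmx.
have uV : x^T *m invmx H = u^T by rewrite /u trmx_mul trmx_inv Hs.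
rewrite mulmxDl !mulmxBr mulmxV // -!scalemxAr mulmxA Hu -mulmxA uV.
rewrite [x *m x^T *m _]mulmxA -[x *m x^T *m u]mulmxA mul_dot.
have -> : dot x u = w by rewrite /w qformE.
rewrite -scalemxAl scalerA.
have -> : (1 + w)^-1 * w = 1 - (1 + w)^-1.
  by field; rewrite gt_eqF // ltr_pwDl.
set N := x *m u^T.
by apply/matrixP => i j; rewrite !mxE; set n := (N i j); ring.
Qed.

(** By the Sherman-Morrison formula the gap between the two sides is exactly g^2 / (1 + w2), where g
    = x . H^-1 S; dropping it leaves a recursion that is linear in g. *)
Lemma qform_invmx_rank1 H x S psi : posdef H ->
  qform (invmx (H + x *m x^T)) (S + psi *: x)
  <= qform (invmx H) S
     + (2 * psi * dot x (invmx H *m S) + psi ^+ 2 * qform (invmx H) x)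
       / (1 + qform (invmx H) x).
Proof.
set g := dot x _; set w2 := qform (invmx H) x.
move=> pH; have uH := posdef_unit pH; case: (pH) => Hs _.
have w0 : 0 <= w2 by apply/posdef_qform_ge0/posdef_inv.
have w1 : 0 < 1 + w2 by rewrite ltr_pwDl.
rewrite sherman_morrison // -/w2; set y := S + _.
have -> : qform (invmx H - (1 + w2)^-1 *: (invmx H *m x *m (invmx H *m x)^T)) y
   = qform (invmx H) y - dot (invmx H *m x) y ^+ 2 / (1 + w2).
  by rewrite qformD -qform_rank1 !qformE mulNmx dotNr -scalemxAl dotZr [X in _ = _ - X]mulrC.
have Hi : (invmx H)^T = invmx H by rewrite trmx_inv Hs.
have -> : dot (invmx H *m x) y = g + psi * w2.
  by rewrite dot_mulmxl Hi /y mulmxDr dotDr -scalemxAr dotZr /g /w2 qformE.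
have -> : qform (invmx H) y = qform (invmx H) S + 2 * psi * g + psi ^+ 2 * w2.
  rewrite /y [LHS]qformE mulmxDr -scalemxAr dotDl !dotDr !dotZl !dotZr /w2 !qformE.
  rewrite -/g; have -> : dot S (invmx H *m x) = g by rewrite dotC dot_mulmxl Hi.
  by ring.
rewrite -subr_ge0.
have -> : qform (invmx H) S + (2 * psi * g + psi ^+ 2 * w2) / (1 + w2) -
  (qform (invmx H) S + 2 * psi * g + psi ^+ 2 * w2 - (g + psi * w2) ^+ 2 / (1 + w2))
  = g ^+ 2 / (1 + w2).
  by field; rewrite gt_eqF.
by rewrite divr_ge0 ?sqr_ge0 // ltW.
Qed.

(** Two block triangular factorizations of one bordered matrix, lower times upper and upper times
    lower. *)
Lemma det_1D_rank1 (u v : 'cV[R]_d) : \det (1%:M + u *m v^T) = 1 + dot v u.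
Proof.
have h1 : block_mx 1%:M (- v^T) u 1%:M
   = block_mx 1%:M 0 u 1%:M *m block_mx 1%:M (- v^T) 0 (1%:M + u *m v^T) :> 'M[R]_(1 + d)%N.
  rewrite mulmx_block !mul1mx !mulmx1 ?mul0mx ?mulmx0 ?addr0 mulmxN.
  by congr block_mx; rewrite addrC addrK.
have h2 : block_mx 1%:M (- v^T) u 1%:M
   = block_mx (1%:M + v^T *m u) (- v^T) 0 1%:M *m block_mx 1%:M 0 u 1%:M :> 'M[R]_(1 + d)%N.
  rewrite mulmx_block !mul1mx !mulmx1 ?mul0mx ?mulmx0 ?addr0 ?add0r mulNmx.
  by congr block_mx; rewrite addrK.
have := congr1 determinant h1; rewrite {1}h2 !det_mulmx !det_ublock !det_lblock !det1.
rewrite !mul1r !mulr1 => <-; rewrite [X in \det X]mx11_scalar det_scalar1 !mxE eqxx.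
by rewrite mulr1n /dot mxE.
Qed.

Lemma det_rank1 H x : posdef H ->
  \det (H + x *m x^T) = \det H * (1 + qform (invmx H) x).
Proof.
move=> pH; have uH := posdef_unit pH.
have -> : H + x *m x^T = H *m (1%:M + (invmx H *m x) *m x^T).
  by rewrite mulmxDr mulmx1 !mulmxA mulmxV // mul1mx.
by rewrite det_mulmx det_1D_rank1 qformE.
Qed.

End PositiveDefinite.

(* Induction on the dimension through the Schur complement: det A is the corner
   entry times det of the complement, whose trace does not exceed that of the
   remaining block. *)
Lemma posdef_det_expR (R : realType) (d : nat) (A : 'M[R]_d) : posdef A ->
  0 < \det A <= expR (\tr A - d%:R).
Proof.
elim: d A => [|d IH] A pA.
  by rewrite det_mx00 /mxtrace big_ord0 subr0 expR0 ltr01 lexx.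
case: (pA) => As A0; rewrite -[d.+1]/(1 + d)%N in A pA As A0 *.
set a := A 0 0; set b := dlsubmx A; set C := drsubmx A.
have urE : ursubmx A = b^T by rewrite /b -{2}As -trmx_ursub trmxK.
have ulE : ulsubmx A = a%:M.
  rewrite [LHS]mx11_scalar !mxE /a; congr (A _ _)%:M; exact/val_inj.
have AE : A = block_mx a%:M b^T b C by rewrite -[LHS]submxK ulE urE.
have Cs : C^T = C by rewrite /C trmx_drsub As.
have a0 : 0 < a.
  have n0 : (col_mx 1%:M 0 : 'cV[R]_(1 + d)) != 0.
    by rewrite col_mx_eq0 negb_and oner_eq0.
  have := A0 _ n0; rewrite /qform AE tr_col_mx mul_row_block mul_row_col.
  by rewrite !trmx0 !mulmx0 !mul0mx !addr0 tr_scalar_mx mul1mx mulmx1 mxE eqxx mulr1n.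
pose S := C - a^-1 *: (b *m b^T).
have pS : posdef S.
  split=> [|y y0].
    by rewrite /S linearB /= linearZ /= trmx_mul trmxK Cs.
  (* The first coordinate minimizes the form of [A] for the given [y]; the minimum is the form of
     [S] at [y]. *)
  pose v : 'cV[R]_(1 + d) := col_mx (- (a^-1 * dot b y))%:M y.
  have v0 : v != 0 by rewrite col_mx_eq0 negb_and y0 orbT.
  have := A0 _ v0; congr (_ < _); rewrite /qform AE tr_col_mx mul_row_block mul_row_col.
  rewrite tr_scalar_mx !mul_scalar_mx mxE.
  rewrite !mul_mx_scalar.
  have by_ : b^T *m y = (dot b y)%:M by rewrite /dot -mx11_scalar.
  have yb : y^T *m b = (dot b y)%:M by rewrite dotC /dot -mx11_scalar.
  rewrite yb mulmxDl -scalemxAl by_ /S mulmxBr mulmxBl -scalemxAr -scalemxAl.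
  have -> : y^T *m (b *m b^T) *m y = (dot b y * dot b y)%:M.
    by rewrite scalar_mxM -{1}yb -by_ !mulmxA.
  set Z := y^T *m C *m y; rewrite !mxE eqxx !mulr1n; set c := dot b y.
  by field; rewrite gt_eqF.
have /IH/andP[S0 S1] := pS.
have AF : A = block_mx 1%:M 0 (a^-1 *: b) 1%:M *m block_mx a%:M b^T 0 S.
  rewrite mulmx_block ?mul1mx ?mulmx1 ?mul0mx ?mulmx0 ?addr0 [LHS]AE; congr block_mx.
    by rewrite -scalemxAl mul_mx_scalar scalerA mulVf ?gt_eqF // scale1r.
  by rewrite /S -scalemxAl addrC subrK.
have dA : \det A = a * \det S.
  by rewrite AF det_mulmx det_lblock det_ublock !det1 !mul1r det_scalar1.
have trA : \tr A = a + \tr C.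
  by rewrite [in LHS]AE mxtrace_block mxtrace_scalar mulr1n.
have trS : \tr S <= \tr C.
  rewrite /S linearB /= linearZ /= mxtrace_mulC lerBlDr lerDl mulr_ge0 ?invr_ge0 ?(ltW a0) //.
  by rewrite [b^T *m b]mx11_scalar mxtrace_scalar mulr1n -/(dot b b) dot_ge0.
rewrite dA mulr_gt0 //= trA.
have ea : a <= expR (a - 1) by have := expR_ge1Dx (a - 1); rewrite addrC subrK.
have -> : a + \tr C - (1 + d)%:R = (a - 1) + (\tr C - d%:R) by rewrite natrD; ring.
rewrite expRD ler_pM // ?(ltW a0) ?(ltW S0) //.
by rewrite (le_trans S1) // ler_expR lerD2r.
Qed.

Lemma posdef_det_gt0 (R : realType) (d : nat) (A : 'M[R]_d) :
  posdef A -> 0 < \det A.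
Proof. by move/posdef_det_expR => /andP[]. Qed.

(** This replaces the inequality of arithmetic and geometric means for the eigenvalues: after
    division by m the trace is at most d, so [posdef_det_expR] bounds the determinant by 1. *)
Lemma ln_det_le (R : realType) (d : nat) (A : 'M[R]_d) (m : R) :
  0 < m -> posdef A -> \tr A <= d%:R * m -> ln (\det A) <= d%:R * ln m.
Proof.
move=> m0 pA trA; case: (pA) => As A0.
have pB : posdef (m^-1 *: A).
  split=> [|x x0]; first by rewrite linearZ /= As.
  by rewrite qformE -scalemxAl dotZr -qformE mulr_gt0 ?invr_gt0 ?A0.
have /andP[_] := posdef_det_expR pB.
rewrite detZ linearZ /= => h.
have mA : \det A <= m ^+ d.
  have : m ^- d * \det A <= 1.
    rewrite -exprVn (le_trans h) // -[leRHS]expR0 ler_expR subr_le0 mulrC ler_pdivrMr //.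
  by rewrite mulrC ler_pdivrMr ?exprn_gt0 // mul1r.
rewrite mulr_natl -lnXn // ler_ln ?posrE ?exprn_gt0 //.
exact: posdef_det_gt0.
Qed.

(** * Scalar inequalities *)

Section ScalarInequalities.
Variable R : realType.
Implicit Types x y z v a b p : R.

Lemma expR_le_inv x : x < 1 -> expR x <= (1 - x)^-1.
Proof.
move=> x1; have := expR_ge1Dx (- x); rewrite expRN => h.
by rewrite -[leLHS]invrK lef_pV2 ?posrE ?subr_gt0 ?invr_gt0 ?expR_gt0.
Qed.

(** e <= (8/7)^8 < 3, the eighth power being computed by repeated squaring with rounding. *)
Lemma expR1_le3 : expR 1 <= 3 :> R.
Proof.
have h : expR (8^-1) <= 8 / 7 :> R.
  rewrite (le_trans (expR_le_inv _)) //; first by lra.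
  by rewrite (_ : (1 - 8^-1)^-1 = 8 / 7) //; field.
have -> : 1 = 8%:R * 8^-1 :> R by lra.
rewrite expRM_natl.
have h2 : expR 8^-1 ^+ 2 <= 64 / 49 :> R.
  rewrite expr2 (le_trans (ler_pM _ _ h h)) ?expR_ge0 //; lra.
have h4 : expR 8^-1 ^+ 4 <= 171 / 100 :> R.
  have -> : expR 8^-1 ^+ 4 = expR 8^-1 ^+ 2 * expR 8^-1 ^+ 2 :> R by rewrite -exprD.
  by rewrite (le_trans (ler_pM _ _ h2 h2)) ?exprn_ge0 ?expR_ge0 //; lra.
have -> : expR 8^-1 ^+ 8 = expR 8^-1 ^+ 4 * expR 8^-1 ^+ 4 :> R by rewrite -exprD.
by rewrite (le_trans (ler_pM _ _ h4 h4)) ?exprn_ge0 ?expR_ge0 //; lra.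
Qed.

Lemma ln3_ge1 : 1 <= ln 3 :> R.
Proof. by rewrite -[leLHS]expRK ler_ln ?posrE ?expR_gt0 // expR1_le3. Qed.

Lemma ln_ge_1BV x : 0 < x -> 1 - x^-1 <= ln x.
Proof.
move=> x0; have xV : 0 < x^-1 by rewrite invr_gt0.
have h : -1 < x^-1 - 1 by lra.
have := le_ln1Dx h; rewrite (addrC 1) subrK lnV ?posrE //; lra.
Qed.

Lemma ln_le_B1 x : 0 < x -> ln x <= x - 1.
Proof.
by move=> x0; have := @le_ln1Dx _ (x - 1); rewrite (addrC 1) subrK; apply; lra.
Qed.

Lemma ln2_ge_half : 1 / 2 <= ln 2 :> R.
Proof. by have := @ln_ge_1BV 2 (ltr0n _ 2); lra. Qed.

(** By convexity the exponential lies below its chord over [0, 1], whose slope e - 1 is at most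
    2. *)
Lemma expR_le1D2x x : 0 <= x <= 1 -> expR x <= 1 + 2 * x.
Proof.
move=> /andP[x0 x1].
have := convex_expR (Itv01 x0 x1) 1 0; rewrite !convRE /= /unstable.onem expR0 !mulr1 mulr0 addr0.
have := expR1_le3; nra.
Qed.

(** Squaring e^(x/2) <= 1 / (1 - x/2) reduces the claim to a polynomial inequality in y = x/2, which
    the factorization below settles for y <= 1/2. *)
Lemma expR_le1Dx2x2 x : -1 <= x <= 1 -> expR x <= 1 + x + 2 * x ^+ 2.
Proof.
move=> /andP[x1 x2].
have h : expR (x / 2) <= (1 - x / 2)^-1 by apply: expR_le_inv; lra.
have -> : x = 2%:R * (x / 2) by lra.
rewrite expRM_natl (le_trans (lerXn2r 2 _ _ h)) ?nnegrE ?expR_ge0 ?invr_ge0 //; first by lra.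
have : - (1 / 2) <= x / 2 <= 1 / 2 by lra.
set y := x / 2 => /andP[y1 y2].
rewrite exprVn invf_ple ?posrE ?exprn_gt0 //; try lra.
- rewrite -[leLHS]mul1r ler_pdivrMr; last by nra.
  have -> : (1 - y) ^+ 2 * (1 + 2%:R * y + 2 * (2%:R * y) ^+ 2)
    = 1 + y ^+ 2 * (1 - 2 * y) * (5 - 4 * y) by ring.
  rewrite lerDl; apply: mulr_ge0; last by lra.
  by apply: mulr_ge0; [exact: sqr_ge0 | lra].
- by nra.
Qed.

Definition clip x : R := Num.max (-1) (Num.min 1 x).

Lemma clip_bounds x : -1 <= clip x <= 1.
Proof. by rewrite /clip le_max lexx ge_max ge_min lexx /= andbT; lra. Qed.

Lemma clip_id x : -1 <= x <= 1 -> clip x = x.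
Proof.
by move=> /andP[x1 x2]; rewrite /clip (min_idPr x2) (max_idPr x1).
Qed.

Lemma clip_gt1 x : 1 <= x -> clip x = 1.
Proof. by move=> x1; rewrite /clip (min_idPl x1); apply/max_idPr; lra. Qed.

Lemma clip_ltN1 x : x <= -1 -> clip x = -1.
Proof.
by move=> x1; rewrite /clip; apply/max_idPl; rewrite ge_min x1 orbT.
Qed.

Variant clip_spec x : R -> Type :=
  | ClipId of -1 <= x <= 1 : clip_spec x x
  | ClipUp of 1 < x : clip_spec x 1
  | ClipDown of x < -1 : clip_spec x (-1).

Lemma clipP x : clip_spec x (clip x).
Proof.
have [x1|x1] := ltP 1 x; first by rewrite clip_gt1 ?ltW //; constructor.
have [x2|x2] := ltP x (-1); first by rewrite clip_ltN1 ?ltW //; constructor.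
by rewrite clip_id ?x2 ?x1 //; constructor; rewrite x2 x1.
Qed.

Lemma clip_sqr_le_powR x p : 1 <= p <= 2 -> clip x ^+ 2 <= `|x| `^ p.
Proof.
move=> /andP[p1 p2]; have [x1|x1|x1] := clipP x.
- have nx1 : `|x| <= 1 by rewrite ler_norml.
  rewrite -[leLHS]real_normK ?num_real //.
  have [->|x0] := eqVneq x 0; first by rewrite normr0 expr0n powR_ge0.
  rewrite -powR_mulrn // ger_powR // nx1 andbT normr_gt0 //.
- rewrite expr1n (le_trans (ltW x1)) // (le_trans (ler_norm _)) //.
  by rewrite le1r_powR // ler_normr ltW.
- rewrite sqrrN expr1n; have x1' : 1 <= `|x| by rewrite ler_normr; lra.
  by rewrite (le_trans x1') // le1r_powR.
Qed.

(** The linear term carries x and not [clip x], because x is the centered quantity. For |x| > 1 the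
    bias |x| - 1 and the quadratic term, at most 2, add up to |x| + 1 <= 2 |x|^p. *)
Lemma expR_clip_le v x p : -1 <= v <= 1 -> 1 <= p <= 2 ->
  expR (v * clip x) <= 1 + v * x + 2 * `|x| `^ p.
Proof.
move=> v1 p12; have /andP[p1 p2] := p12; have c1 := clip_bounds x.
have h : expR (v * clip x) <= 1 + v * clip x + 2 * (v * clip x) ^+ 2.
  by apply: expR_le1Dx2x2; nra.
rewrite (le_trans h) //.
have v2 : v ^+ 2 <= 1 by nra.
have := clip_sqr_le_powR x p12.
have c20 : 0 <= clip x ^+ 2 by apply: sqr_ge0.
case: (clipP x) => [_|x1|x1] in c1 c20 h *.
- by rewrite exprMn => hc; nra.
- move=> _; have : `|x| <= `|x| `^ p by rewrite le1r_powR // ler_normr ltW.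
  have := ler_norm x; rewrite mulr1; nra.
- move=> _; have : `|x| <= `|x| `^ p by rewrite le1r_powR // ler_normr; lra.
  have := ler_norm (- x); rewrite normrN; nra.
Qed.

Lemma expR_clip2_le x p : 1 <= p <= 2 ->
  expR (clip x ^+ 2) <= 1 + 2 * `|x| `^ p.
Proof.
move=> p12; have c1 := clip_bounds x.
rewrite (le_trans (expR_le1D2x _)) //; first by nra.
by rewrite lerD2l ler_pM2l // clip_sqr_le_powR.
Qed.

Lemma weighted_AMGM a b p : 0 <= a -> 0 <= b -> 0 < p <= 1 ->
  a `^ p * b `^ (1 - p) <= p * a + (1 - p) * b.
Proof.
move=> a0 b0 /andP[p0]; rewrite le_eqVlt => /predU1P[->|p1].
  (* At p = 1 the conjugate exponent is infinite, so this case is separate. *)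
  by rewrite subrr powRr0 powRr1 // mulr1 mul1r mul0r addr0.
have q0 : 0 < 1 - p by lra.
have := @conjugate_powR _ (a `^ p) (b `^ (1 - p)) p^-1 (1 - p)^-1.
rewrite !powR_ge0 !invr_gt0 !invrK p0 q0 -!powRrM !mulfV ?gt_eqF // !powRr1 //.
move=> /(_ isT isT isT isT) h; rewrite [p * a]mulrC [(1 - p) * b]mulrC; apply: h; lra.
Qed.

Lemma harmonic_le n : (0 < n)%N ->
  \sum_(1 <= s < n.+1) (s%:R : R)^-1 <= 1 + ln n%:R.
Proof.
elim: n => // -[_ _|n IH _]; first by rewrite big_nat1 ln1 invr1 addr0.
rewrite big_nat_recr //= (le_trans (lerD (IH isT) (lexx _))) // -addrA lerD2l.
have n0 : 0 < n.+1%:R :> R by rewrite ltr0n.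
have n1 : 0 < n.+2%:R :> R by rewrite ltr0n.
rewrite -lerBrDl -ln_div ?posrE //.
have := @ln_ge_1BV (n.+2%:R / n.+1%:R) (divr_gt0 n1 n0).
rewrite invf_div; apply: le_trans; rewrite -natr1 in n1 *.
set m : R := n.+1%:R in n0 n1 *.
by rewrite le_eqVlt; apply/orP; left; apply/eqP; field; rewrite gt_eqF.
Qed.

Lemma ln1D_ge_half x : 0 <= x <= 1 -> x <= 2 * ln (1 + x).
Proof.
move=> /andP[x0 x1]; have x10 : 0 < 1 + x by lra.
have := ln_ge_1BV x10.
have : x / 2 <= 1 - (1 + x)^-1.
  rewrite -subr_ge0 (_ : _ - _ = x * (1 - x) / (2 * (1 + x))); last by field; rewrite gt_eqF.
  by apply: divr_ge0; [apply: mulr_ge0; lra | lra].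
lra.
Qed.

Lemma sqr_le_imp x y : 0 <= y -> x ^+ 2 <= y ^+ 2 -> x <= y.
Proof. by move=> y0 h; have [//|xy] := leP x y; nra. Qed.

End ScalarInequalities.

Lemma powRV (R : realType) (x p : R) : 0 <= x -> x^-1 `^ p = (x `^ p)^-1.
Proof. by move=> x0; rewrite -powR_inv1 // powRAC powR_inv1 // powR_ge0. Qed.

(** * Tuning of the thresholds by Hoelder's inequality *)

Section HoelderTuning.
Variables (R : realType) (eps : R).
Hypothesis eps01 : 0 < eps <= 1.

Definition rate : R := (1 - eps) / (2 * (1 + eps)).

Lemma rate_ge0 : 0 <= rate.
Proof. by case/andP: eps01 => ? ?; rewrite divr_ge0 ?mulr_ge0 //; lra. Qed.

Lemma rate_le1 : rate <= 1.
Proof. by case/andP: eps01 => ? ?; rewrite ler_pdivrMr; lra. Qed.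

(** With p = (1 + eps) / 2 the right side is 1 - p, the weight of the harmonic sum in Hoelder's
    inequality. *)
Lemma rate_mul1D : rate * (1 + eps) = 1 - (1 + eps) / 2.
Proof. by case/andP: eps01 => ? ?; rewrite /rate; field; lra. Qed.

(* Hoelder's inequality with exponents 2/(1+eps) and 2/(1-eps), done term by
   term so that the case eps = 1 needs no separate treatment. *)
Lemma sum_powR_tuned (T : nat) (w : nat -> R) (W h l : R) :
  0 < W -> 0 < h -> 0 < l -> (forall s, 0 <= w s) ->
  \sum_(1 <= s < T.+1) w s ^+ 2 <= W ->
  \sum_(1 <= s < T.+1) (s%:R)^-1 <= h ->
  \sum_(1 <= s < T.+1)
     (w s / (Num.sqrt W * h `^ rate / l `^ (1 / (1 + eps)) * s%:R `^ rate))
       `^ (1 + eps) <= l.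
Proof.
move=> W0 h0 l0 w0 sW sh; case/andP: (eps01) => e0 e1.
set p := (1 + eps) / 2.
have p01 : 0 < p <= 1 by rewrite /p; lra.
have e1n0 : 1 + eps != 0 by rewrite gt_eqF //; lra.
rewrite [leRHS](_ : l = l * (p * 1 + (1 - p) * 1)); last by ring.
have sW' : \sum_(1 <= s < T.+1) w s ^+ 2 / W <= 1.
  by rewrite -mulr_suml ler_pdivrMr // mul1r.
have sh' : \sum_(1 <= s < T.+1) (s%:R * h)^-1 <= 1.
  rewrite (eq_bigr (fun s => s%:R^-1 / h)) => [|s _]; last by rewrite invfM.
  by rewrite -mulr_suml ler_pdivrMr // mul1r.
have {}sW' : p * (\sum_(1 <= s < T.+1) w s ^+ 2 / W) <= p * 1 by rewrite ler_pM2l //; lra.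
have {}sh' : (1 - p) * (\sum_(1 <= s < T.+1) (s%:R * h)^-1) <= (1 - p) * 1.
  by rewrite ler_wpM2l //; lra.
rewrite (le_trans _ (ler_wpM2l (ltW l0) (lerD sW' sh'))) //.
rewrite !mulr_sumr -big_split /= mulr_sumr ler_sum_nat // => s /andP[s1 _].
have s0 : 0 < s%:R :> R by rewrite ltr0n.
have Wp : (Num.sqrt W) `^ (1 + eps) = W `^ p.
  by rewrite -powR12_sqrt ?(ltW W0) // -powRrM; congr (_ `^ _); rewrite /p; field.
have wp : w s `^ (1 + eps) = (w s ^+ 2) `^ p.
  by rewrite -powR_mulrn // -powRrM; congr (_ `^ _); rewrite /p; field.
have lp : (l `^ (1 / (1 + eps))) `^ (1 + eps) = l.
  by rewrite -powRrM mulrVK ?unitfE // powRr1 // ltW.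
have hp y : (y `^ rate) `^ (1 + eps) = y `^ (1 - p).
  by rewrite -powRrM rate_mul1D.
have V0 : 0 < (1 + eps) by lra.
(* The scale in the denominator is chosen so that the summand becomes l times a weighted geometric
   mean of w_s^2 / W and 1 / (s h), two families whose sums are at most 1. *)
have -> : (w s / (Num.sqrt W * h `^ rate / l `^ (1 / (1 + eps)) * s%:R `^ rate)) `^ (1 + eps)
   = l * ((w s ^+ 2 / W) `^ p * ((s%:R * h)^-1) `^ (1 - p)).
  rewrite powRM ?w0 ?invr_ge0 ?mulr_ge0 ?sqrtr_ge0 ?powR_ge0 ?invr_ge0 ?powR_ge0 //.
  set A := w s; set Q : R := Num.sqrt W.
  have Q0 : 0 <= Q by apply: sqrtr_ge0.
  have [W0' h0' s0' l0'] := And4 (ltW W0) (ltW h0) (ltW s0) (ltW l0).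
  have := powR_ge0 h rate; have := powR_ge0 s%:R rate; have := powR_ge0 l (1 / (1 + eps)).
  move: (hp h) (hp s%:R) lp; set K := h `^ rate; set S := s%:R `^ rate; set L := l `^ _.
  move=> hK hS hL L0 S0 K0.
  have n1 : 0 <= Q * K := mulr_ge0 Q0 K0; have n2 : 0 <= Q * K / L := divr_ge0 n1 L0.
  have n3 : 0 <= Q * K / L * S := mulr_ge0 n2 S0; have LV : 0 <= L^-1 by rewrite invr_ge0.
  rewrite (powRV _ n3) (powRM _ n2 S0) (powRM _ n1 LV) (powRM _ Q0 K0) (powRV _ L0).
  rewrite hK hS hL Wp (@powRM _ (A ^+ 2)) ?sqr_ge0 ?invr_ge0 // [W^-1 `^ _]powRV //.
  rewrite [(_ * h)^-1 `^ _]powRV; last exact: mulr_ge0.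
  rewrite powRM // -wp.
  by field; rewrite !gt_eqF ?powR_gt0.
rewrite ler_pM2l // weighted_AMGM // ?divr_ge0 ?sqr_ge0 ?(ltW W0) ?invr_ge0 ?mulr_ge0 ?(ltW h0) //.
Qed.

End HoelderTuning.

(** * The Huber loss *)

Section Huber.
Variable R : realType.
Implicit Types u v z y rho : R.

(** The loss with threshold 1, to which [huberE] reduces every finite threshold by scaling; [clip]
    is its derivative. *)
Definition huber1 u : R := if `|u| <= 1 then u ^+ 2 / 2 else `|u| - 1 / 2.

Lemma huberE rho z : 0 < rho -> huber (rho^-1)%:E z = huber1 (rho * z) / rho ^+ 2.
Proof.
move=> r0; rewrite /huber /huber1 lee_fin normrM (gtr0_norm r0) -ler_pdivlMl // mulr1.
by case: ifP => _ /=; field; rewrite gt_eqF.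
Qed.

(** Together with [huber1_ge] this is convex duality: [huber1 u] is the maximum of c u - c^2 / 2
    over c in [-1, 1], attained at c = [clip u]. *)
Lemma huber1_clip u : huber1 u = clip u * u - clip u ^+ 2 / 2.
Proof.
rewrite /huber1; case: (clipP u) => [u1|u1|u1].
- by rewrite ler_norml u1; field.
- rewrite ifF; last by apply/negbTE; rewrite -ltNge ltr_normr u1.
  by rewrite gtr0_norm; lra.
- rewrite ifF; last by apply/negbTE; rewrite -ltNge ltr_normr; lra.
  by rewrite ltr0_norm; lra.
Qed.

Lemma huber1_ge u c : -1 <= c <= 1 -> c * u - c ^+ 2 / 2 <= huber1 u.
Proof.
move=> c1; rewrite huber1_clip; case: (clipP u) => [u1|u1|u1].
- by have := sqr_ge0 (c - u); rewrite sqrrB; lra.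
- have : 0 <= (1 - c) * (u - (1 + c) / 2) by rewrite mulr_ge0; lra.
  by rewrite expr1n; lra.
- have : 0 <= (1 + c) * (- u - (1 - c) / 2) by rewrite mulr_ge0; lra.
  by rewrite sqrrN expr1n; lra.
Qed.

(** If |u| <= 2/3, both u and u - v lie in [-1, 1], where the loss is exactly quadratic. Otherwise
    the dual bound [huber1_ge] with c = [clip u] is the tangent inequality at u. *)
Lemma huber1_lower u v : `|v| <= 1 / 3 ->
  huber1 u - clip u * v + (if `|u| <= 2 / 3 then v ^+ 2 / 2 else 0)
  <= huber1 (u - v).
Proof.
rewrite ler_norml => v3; case: ifPn => [|_].
  rewrite ler_norml => u3; rewrite clip_id; last by lra.
  rewrite /huber1 !ifT ?ler_norml; [|lra..]; nra.
rewrite addr0 {1}huber1_clip; apply: le_trans (huber1_ge _ (clip_bounds u)).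
by rewrite mulrBr; lra.
Qed.

Lemma huber_lower rho z y : 0 < rho -> `|rho * y| <= 1 / 3 ->
  huber (rho^-1)%:E z - clip (rho * z) / rho * y
    + (if `|rho * z| <= 2 / 3 then y ^+ 2 / 2 else 0)
  <= huber (rho^-1)%:E (z - y).
Proof.
move=> r0 h; rewrite !huberE // mulrBr.
have r2 : 0 < rho ^- 2 by rewrite invr_gt0 exprn_gt0.
have := ler_wpM2r (ltW r2) (huber1_lower (rho * z) h).
apply: le_trans; rewrite le_eqVlt; apply/orP; left; apply/eqP.
by case: ifP => _; field; rewrite gt_eqF.
Qed.

End Huber.

(** * Elliptical potential *)

Section Path.
Variables (R : realType) (d : nat) (I : hoful_input R).
Variables (phi : nat -> 'cV[R]_d) (nu : nat -> R).
Hypotheses (lam0 : 0 < lambda I) (smin0 : 0 < sigma_min I).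

Local Notation H := (Hmat I phi nu).
Local Notation sg := (sigma I phi nu).
Local Notation w := (weight I phi nu).

Definition feature (s : nat) : 'cV[R]_d := (sg s)^-1 *: phi s.

Lemma sigma_ge_nu s : nu s <= sg s.
Proof. by rewrite /sigma /sigma_step le_max lexx. Qed.

Lemma sigma_ge_min s : sigma_min I <= sg s.
Proof. by rewrite /sigma /sigma_step !le_max lexx !orbT. Qed.

Lemma sigma_gt0 s : 0 < sg s.
Proof. exact: lt_le_trans (sigma_ge_min s). Qed.

Lemma HmatS t : H t.+1 = H t + feature t.+1 *m (feature t.+1)^T.
Proof.
rewrite /= /feature linearZ /= -scalemxAl -scalemxAr scalerA.
by rewrite -invfM -expr2.
Qed.

Lemma Hmat_posdef t : posdef (H t).
Proof.
elim: t => [|t IH]; first exact: posdef_scalar.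
by rewrite HmatS; exact: posdef_rank1.
Qed.
Local Hint Resolve Hmat_posdef : core.

Lemma posdef_invHmat t : posdef (invmx (H t)).
Proof. exact: posdef_inv. Qed.
Local Hint Resolve posdef_invHmat : core.

Lemma wnormZ (A : 'M[R]_d) (a : R) x : 0 <= a -> wnorm A (a *: x) = a * wnorm A x.
Proof.
move=> a0; rewrite /wnorm -!/(qform _ _) qformZ sqrtrM ?sqr_ge0 //.
by rewrite sqrtr_sqr ger0_norm.
Qed.

Lemma weightE s : w s = (sg s)^-1 * wnorm (invmx (H s.-1)) (phi s).
Proof. by rewrite /weight wnormZ // invr_ge0 ltW // sigma_gt0. Qed.

Lemma weight_ge0 s : 0 <= w s.
Proof. exact: wnorm_ge0. Qed.

Lemma weight_sqr s : w s ^+ 2 = qform (invmx (H s.-1)) (feature s).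
Proof. by rewrite wnorm_sqr // posdef_qform_ge0. Qed.

(** The inverse of H_{s-1} is positive definite. A round with infinite threshold thus has a zero
    feature and drops out of the score sum and of the comparison of losses. *)
Lemma weight_eq0 s : w s = 0 -> feature s = 0.
Proof.
move=> w0; apply/eqP; have := weight_sqr s; rewrite w0 expr0n /=.
by case: eqVneq => // f0; case: (posdef_invHmat s.-1) => _ /(_ _ f0) /[swap] <-; rewrite ltxx.
Qed.

Lemma weight_le_c0 s : 0 < c0 I -> w s <= c0 I.
Proof.
move=> c0; rewrite weightE mulrC ler_pdivrMr ?sigma_gt0 // mulrC -ler_pdivrMr //.
by rewrite /sigma /sigma_step !le_max lexx !orbT.
Qed.

Lemma qform_Hmat t y :
  qform (H t) y = lambda I * dot y y + \sum_(1 <= s < t.+1) dot (feature s) y ^+ 2.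
Proof.
elim: t => [|t IH]; first by rewrite big_geq // addr0 qform_scalar.
by rewrite HmatS big_nat_recr //= qformD IH qform_rank1 addrA.
Qed.

Lemma qform_Hmat_mono s t y : (s <= t)%N -> qform (H s) y <= qform (H t) y.
Proof.
move=> st; rewrite !qform_Hmat lerD2l [leRHS](big_cat_nat (n := s.+1)) //= lerDl.
by apply: sumr_ge0 => i _; apply: sqr_ge0.
Qed.

Lemma trace_Hmat t :
  \tr (H t) = d%:R * lambda I + \sum_(1 <= s < t.+1) dot (feature s) (feature s).
Proof.
elim: t => [|t IH]; first by rewrite big_geq // addr0 mxtrace_scalar mulr_natl.
rewrite HmatS big_nat_recr //= linearD /= IH addrA; congr (_ + _).
by rewrite mxtrace_mulC /mxtrace big_ord1.
Qed.

Lemma ln_det_Hmat t :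
  ln (\det (H t)) = d%:R * ln (lambda I) + \sum_(1 <= s < t.+1) ln (1 + w s ^+ 2).
Proof.
elim: t => [|t IH]; first by rewrite big_geq // addr0 det_scalar lnXn // mulr_natl.
rewrite HmatS big_nat_recr //= det_rank1 // lnM ?posrE ?posdef_det_gt0 //.
  by rewrite IH addrA weight_sqr.
by rewrite ltr_pwDl // posdef_qform_ge0.
Qed.

Hypothesis phi_le : forall s, (1 <= s <= horizon I)%N -> norm2 (phi s) <= arm_bound I.
Hypotheses (d0 : (0 < d)%N) (c0_gt0 : 0 < c0 I) (c0_le1 : c0 I <= 1).

(** By [ln_det_Hmat] the sum equals ln det H_t - d ln lambda. Each feature has norm at most L /
    sigma_min, which bounds the trace of H_t, and [ln_det_le] turns this bound into [kappa]. *)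
Lemma sum_ln_weight t : (t <= horizon I)%N ->
  \sum_(1 <= s < t.+1) ln (1 + w s ^+ 2) <= kappa d I.
Proof.
move=> tT; set T := horizon I; set L := arm_bound I.
have dR : 0 < d%:R :> R by rewrite ltr0n.
set c := T%:R * L ^+ 2 / (d%:R * lambda I * sigma_min I ^+ 2).
have c0 : 0 <= c.
  by rewrite divr_ge0 // mulr_ge0 ?sqr_ge0 // mulr_ge0 // ltW.
have c1 : 0 < 1 + c by rewrite ltr_pwDl.
have m0 : 0 < lambda I * (1 + c) by rewrite mulr_gt0.
have trH : \tr (H t) <= d%:R * (lambda I * (1 + c)).
  have -> : d%:R * (lambda I * (1 + c)) = d%:R * lambda I + T%:R * (L ^+ 2 / sigma_min I ^+ 2).
    by rewrite /c; field; rewrite !gt_eqF.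
  rewrite trace_Hmat lerD2l.
  have hs s : (1 <= s < t.+1)%N -> dot (feature s) (feature s) <= L ^+ 2 / sigma_min I ^+ 2.
    move=> /andP[s1 st]; have fL : norm2 (phi s) <= L.
      by apply: phi_le; rewrite s1; exact: leq_trans tT.
    rewrite /feature dotZl dotZr mulrA -expr2 exprVn -norm2_sqr mulrC.
    rewrite ler_pM ?invr_ge0 ?sqr_ge0 //.
      by rewrite ler_sqr ?nnegrE ?norm2_ge0 // (le_trans (norm2_ge0 _) fL).
    rewrite lef_pV2 ?posrE ?exprn_gt0 ?sigma_gt0 //.
    by rewrite ler_sqr ?nnegrE ?sigma_ge_min // ltW ?sigma_gt0.
  rewrite (le_trans (ler_sum_nat hs)) // sumr_const_nat subn1 /= -[leLHS]mulr_natl.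
  by rewrite ler_wpM2r ?ler_nat // divr_ge0 ?sqr_ge0.
have := ln_det_le m0 (Hmat_posdef t) trH.
by rewrite ln_det_Hmat lnM ?posrE // mulrDr lerD2l.
Qed.

(** The cap [c0] <= 1 on the weights permits w^2 <= 2 ln (1 + w^2). *)
Lemma sum_weight_sqr t : (t <= horizon I)%N ->
  \sum_(1 <= s < t.+1) w s ^+ 2 <= 2 * kappa d I.
Proof.
move=> tT; rewrite (le_trans _ (ler_wpM2l _ (sum_ln_weight tT))) // mulr_sumr.
apply: ler_sum => s _; apply: ln1D_ge_half; rewrite sqr_ge0 /=.
by rewrite expr_le1 // ?weight_ge0 // (le_trans (weight_le_c0 _ _)).
Qed.

End Path.

(** * Confidence sets *)

Section Scores.
Variables (R : realType) (d : nat) (I : hoful_input R) (eps : R).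
Variables (phi : nat -> 'cV[R]_d) (nu noise : nat -> R).
Hypotheses (lam0 : 0 < lambda I) (smin0 : 0 < sigma_min I) (tau00 : 0 < tau0 I).
Hypothesis eps01 : 0 < eps <= 1.

Local Notation H := (Hmat I phi nu).
Local Notation sg := (sigma I phi nu).
Local Notation w := (weight I phi nu).
Local Notation x := (feature I phi nu).
Local Notation a := (rate eps).

(* The inverse of tau_s, with the value 0 for the infinite threshold. *)
Definition inv_tau (s : nat) : R :=
  w s / Num.sqrt (1 + w s ^+ 2) / (tau0 I * s%:R `^ a).

(* The clipped score is psi_s / tau_s, where psi_s is the derivative of the
   Huber loss at the normalized noise. *)
Definition score (s : nat) : R := clip (inv_tau s * (noise s / sg s)).

(** If w_s = 0, then [inv_tau s] = 0 and the quotient is 0 by convention; the feature is 0 as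
    well. *)
Definition score_sum (t : nat) : 'cV[R]_d :=
  \sum_(1 <= s < t.+1) (score s / inv_tau s) *: x s.

(** Normalized so that the linear term of the rank-one update is 2 [score s] tau_0 s^a times it, and
    so that its absolute value is at most the norm of the previous score sum ([score_dir_le]). *)
Definition score_dir (s : nat) : R :=
  dot (x s) (invmx (H s.-1) *m score_sum s.-1) / (w s * Num.sqrt (1 + w s ^+ 2)).

(** The first factor compensates the growth of the thresholds from s to t. The divisor inside the
    clip is the bound that [score_sum_bound] proves at t, so the clip can act only if that bound
    fails at time s - 1. *)
Definition score_coef (ell : R) (t s : nat) : R :=
  s%:R `^ a / t%:R `^ a * clip (score_dir s / (8 * tau0 I * t%:R `^ a * ell)).

Let sq1w s : 0 < Num.sqrt (1 + w s ^+ 2).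
Proof. by rewrite sqrtr_gt0 ltr_pwDl // sqr_ge0. Qed.

Let spow s : (0 < s)%N -> 0 < (s%:R : R) `^ a.
Proof. by move=> s0; rewrite powR_gt0 // ltr0n. Qed.

Lemma pow_rate_mono (s t : nat) : (s <= t)%N -> (s%:R : R) `^ a <= t%:R `^ a.
Proof.
by move=> st; rewrite ge0_ler_powR ?rate_ge0 ?nnegrE // ler_nat.
Qed.

Lemma inv_tau_ge0 s : 0 <= inv_tau s.
Proof.
by rewrite /inv_tau !divr_ge0 ?mulr_ge0 ?weight_ge0 ?powR_ge0 ?sqrtr_ge0 // ltW.
Qed.

Lemma inv_tau_gt0 s : (0 < s)%N -> w s != 0 -> 0 < inv_tau s.
Proof.
move=> s0 ws0; have w0 : 0 < w s by rewrite lt_neqAle eq_sym ws0 weight_ge0.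
by rewrite /inv_tau !divr_gt0 ?mulr_gt0 ?spow.
Qed.

Lemma tauE s : (0 < s)%N -> w s != 0 ->
  tau eps I phi nu s = ((inv_tau s)^-1)%:E.
Proof.
move=> s0 ws0; rewrite /tau /= (negbTE ws0) -/a; congr _%:E.
rewrite /inv_tau; field; rewrite ws0 !gt_eqF ?sq1w ?spow //.
Qed.

Lemma inv_tau_le s : (0 < s)%N -> inv_tau s <= w s / (tau0 I * s%:R `^ a).
Proof.
move=> s0; rewrite ler_wpM2r ?invr_ge0 ?mulr_ge0 ?powR_ge0 ?(ltW tau00) //.
rewrite ler_pdivrMr // ler_peMr ?weight_ge0 //.
rewrite -[leLHS]sqrtr1 ler_wsqrtr // lerDl sqr_ge0 //.
Qed.

(** The factor sqrt (1 + w^2) / w of the threshold is made for this step: it cancels the w^2 / (1 +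
    w^2) of the rank-one update, and the quadratic term becomes free of the weight. *)
Lemma score_sum_step t :
  qform (invmx (H t.+1)) (score_sum t.+1) <=
  qform (invmx (H t)) (score_sum t)
  + (2 * score t.+1 * (tau0 I * t.+1%:R `^ a) * score_dir t.+1
     + score t.+1 ^+ 2 * (tau0 I * t.+1%:R `^ a) ^+ 2).
Proof.
set s := t.+1.
have SE : score_sum s = score_sum t + (score s / inv_tau s) *: x s.
  by rewrite /score_sum big_nat_recr.
have [w0|ws0] := eqVneq (w s) 0.
  have x0 : x s = 0 by apply: weight_eq0 w0.
  rewrite SE /s HmatS // -/s x0 scaler0 mul0mx !addr0 lerDl.
  rewrite /score_dir x0 dot0l mul0r mulr0 add0r mulr_ge0 ?sqr_ge0 //.
have pH : posdef (H t) by apply: Hmat_posdef.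
rewrite SE /s HmatS // -/s; set psi := score s / inv_tau s.
apply: le_trans (qform_invmx_rank1 (x s) (score_sum t) psi pH) _.
rewrite lerD2l -[invmx (H t)]/(invmx (H s.-1)) -weight_sqr //.
set g := dot (x s) _.
have s0 : (0 < s)%N by [].
rewrite /score_dir -/g /psi /inv_tau.
have r2 : Num.sqrt (1 + w s ^+ 2) ^+ 2 = 1 + w s ^+ 2.
  by rewrite sqr_sqrtr // addr_ge0 // sqr_ge0.
have r0 := sq1w s.
set r := Num.sqrt _ in r0 r2 *; rewrite -r2.
rewrite le_eqVlt; apply/orP; left; apply/eqP; field.
by rewrite ws0 !gt_eqF ?spow.
Qed.

Lemma wnorm_invmx_mul t y : wnorm (H t) (invmx (H t) *m y) = wnorm (invmx (H t)) y.
Proof.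
have pH : posdef (H t) by apply: Hmat_posdef.
rewrite /wnorm -!/(qform _ _); congr Num.sqrt.
by rewrite !qformE mulKVmx ?posdef_unit // dotC.
Qed.

Lemma score_dir_le s : `|score_dir s| <= wnorm (invmx (H s.-1)) (score_sum s.-1).
Proof.
rewrite /score_dir; have [w0|ws0] := eqVneq (w s) 0.
  by rewrite w0 mul0r invr0 mulr0 normr0 wnorm_ge0.
have w0 : 0 < w s by rewrite lt_neqAle eq_sym ws0 weight_ge0.
have pH : posdef (H s.-1) by apply: Hmat_posdef.
have d0 : 0 < w s * Num.sqrt (1 + w s ^+ 2) by rewrite mulr_gt0.
rewrite normrM normfV (gtr0_norm d0) ler_pdivrMr //.
rewrite (le_trans (dot_le_wnorm _ _ pH)) // wnorm_invmx_mul mulrC.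
rewrite ler_wpM2l ?wnorm_ge0 // -/(w s) ler_peMr ?weight_ge0 //.
by rewrite -[leLHS]sqrtr1 ler_wsqrtr // lerDl sqr_ge0.
Qed.

Lemma score_coef_bounds ell t s : (0 < s <= t)%N -> -1 <= score_coef ell t s <= 1.
Proof.
move=> /andP[s0 st]; rewrite /score_coef.
have := clip_bounds (score_dir s / (8 * tau0 I * t%:R `^ a * ell)).
have t0 : 0 < (t%:R : R) `^ a by rewrite spow // (leq_trans s0).
have : 0 <= (s%:R : R) `^ a / t%:R `^ a <= 1.
  by rewrite divr_ge0 ?powR_ge0 //= ler_pdivrMr // mul1r pow_rate_mono.
nra.
Qed.

(* Induction on t: if the bound holds with a constant K before round t, the two
   events reproduce it at t as soon as K^2 >= 6 K + 3 / ell; K = 8 will do. *)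
Lemma score_sum_bound (T : nat) (ell : R) : 1 / 2 <= ell ->
  (forall t, (1 <= t <= T)%N ->
     \sum_(1 <= s < t.+1) score_coef ell t s * score s <= 3 * ell) ->
  \sum_(1 <= s < T.+1) score s ^+ 2 <= 3 * ell ->
  forall t, (t <= T)%N ->
    wnorm (invmx (H t)) (score_sum t) <= 8 * tau0 I * t%:R `^ a * ell.
Proof.
move=> ell_ge evA evB t; have ell0 : 0 < ell by lra.
elim/ltn_ind: t => t IH tT; have [t0|t_gt0] := posnP t.
  rewrite t0 /wnorm -/(qform _ _) qformE /score_sum big_geq // mulmx0 dot0l sqrtr0.
  by rewrite !mulr_ge0 ?powR_ge0 // ltW.
set m := 8 * tau0 I * t%:R `^ a * ell.
have ta0 : 0 < (t%:R : R) `^ a by apply: spow.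
have m0 : 0 < m by rewrite !mulr_gt0.
have key u : qform (invmx (H u)) (score_sum u) <= \sum_(1 <= s < u.+1)
   (2 * score s * (tau0 I * s%:R `^ a) * score_dir s
     + score s ^+ 2 * (tau0 I * s%:R `^ a) ^+ 2).
  elim: u => [|u IHu]; last first.
    by rewrite big_nat_recr //= (le_trans (score_sum_step u)) // lerD2r.
  by rewrite qformE /score_sum !big_geq // mulmx0 dot0l.
rewrite -ler_sqr ?nnegrE ?wnorm_ge0 ?(ltW m0) // wnorm_sqr; last first.
  by apply/posdef_qform_ge0/posdef_invHmat.
rewrite (le_trans (key t)) // big_split /=.
have h1 : \sum_(1 <= s < t.+1) 2 * score s * (tau0 I * s%:R `^ a) * score_dir s
   <= 2 * (tau0 I * t%:R `^ a) * m * (3 * ell).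
  have -> : \sum_(1 <= s < t.+1) 2 * score s * (tau0 I * s%:R `^ a) * score_dir s
    = 2 * (tau0 I * t%:R `^ a) * m * \sum_(1 <= s < t.+1) score_coef ell t s * score s.
    rewrite mulr_sumr; apply: eq_big_nat => s /andP[s0 st].
    (* By the induction hypothesis at s - 1 the clip in [score_coef] is the identity, so the event
       speaks of the true linear term. *)
    have hq : `|score_dir s| <= m.
      rewrite (le_trans (score_dir_le s)) //.
      have st' : (s.-1 < t)%N by rewrite prednK.
      rewrite (le_trans (IH _ st' _)) ?(leq_trans (ltnW st')) //.
      rewrite /m ler_wpM2r ?(ltW ell0) // ler_wpM2l ?mulr_ge0 ?(ltW tau00) //.
      exact/pow_rate_mono/ltnW.
    rewrite /score_coef -/m clip_id; last first.
      move: hq; rewrite ler_norml => /andP[q1 q2].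
      by rewrite ler_pdivlMr // mulN1r q1 ler_pdivrMr // mul1r.
    by field; rewrite !gt_eqF.
  rewrite ler_wpM2l ?evA ?t_gt0 //.
  by rewrite !mulr_ge0 // ltW.
have h2 : \sum_(1 <= s < t.+1) score s ^+ 2 * (tau0 I * s%:R `^ a) ^+ 2
   <= (tau0 I * t%:R `^ a) ^+ 2 * (3 * ell).
  have h3 : \sum_(1 <= s < t.+1) score s ^+ 2 <= 3 * ell.
    apply: le_trans evB; rewrite [leRHS](big_cat_nat (n := t.+1)) //= lerDl.
    by apply: sumr_ge0 => i _; apply: sqr_ge0.
  rewrite (le_trans _ (ler_wpM2l (sqr_ge0 _) h3)) // mulr_sumr.
  apply: ler_sum_nat => s /andP[s0 st]; rewrite mulrC ler_wpM2r ?sqr_ge0 //.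
  rewrite ler_sqr ?nnegrE ?mulr_ge0 ?powR_ge0 ?(ltW tau00) //.
  by rewrite ler_wpM2l ?(ltW tau00) // pow_rate_mono.
rewrite (le_trans (lerD h1 h2)) //.
set b := tau0 I * t%:R `^ a.
have -> : m = 8 * b * ell by rewrite /m /b; ring.
have b20 : 0 <= b ^+ 2 by apply: sqr_ge0.
have -> : 2 * b * (8 * b * ell) * (3 * ell) + b ^+ 2 * (3 * ell)
  = b ^+ 2 * (48 * ell ^+ 2 + 3 * ell) by ring.
have -> : (8 * b * ell) ^+ 2 = b ^+ 2 * (64 * ell ^+ 2) by ring.
rewrite ler_wpM2l //; nra.
Qed.

(* Rounds with large noise contribute little to the norm, because there are
   few of them and each weight is at most c0. *)
Lemma bad_rounds_le (T t : nat) (y : 'cV[R]_d) : 0 < c0 I -> (t <= T)%N ->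
  9 / 4 * c0 I ^+ 2 * \sum_(1 <= s < T.+1) score s ^+ 2 <= 1 / 3 ->
  \sum_(1 <= s < t.+1)
     (if `|inv_tau s * (noise s / sg s)| <= 2 / 3 then 0 else dot (x s) y ^+ 2)
  <= 1 / 3 * qform (H t) y.
Proof.
move=> c00 tT hc; have pH s : posdef (H s) by apply: Hmat_posdef.
have q0 : 0 <= qform (H t) y by apply: posdef_qform_ge0.
rewrite (le_trans _ (ler_wpM2r q0 hc)) // mulr_sumr mulr_suml.
have c20 : 0 <= 9 / 4 * c0 I ^+ 2 by rewrite mulr_ge0 ?sqr_ge0.
have F0 s : 0 <= 9 / 4 * c0 I ^+ 2 * score s ^+ 2 * qform (H t) y.
  by apply: mulr_ge0 => //; apply: mulr_ge0 => //; apply: sqr_ge0.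
rewrite [leRHS](big_cat_nat (n := t.+1)) //= ler_wpDr //; first exact: sumr_ge0.
apply: ler_sum_nat => s /andP[s1 st]; set z := inv_tau s * _.
case: ifPn => [_|]; first exact: F0.
rewrite -ltNge => zbig.
(* Origin of the factor 9/4: each such round uses up 4/9 of the sum of squared scores. *)
have sc : 4 / 9 <= score s ^+ 2.
  rewrite /score -/z; case: (clipP z) => [z1|z1|z1]; [|lra|lra].
  by rewrite -(real_normK (num_real z)); nra.
have h1 : dot (x s) y ^+ 2 <= c0 I ^+ 2 * qform (H t) y.
  rewrite (le_trans (CauchySchwarz_posdef _ _ (pH s.-1))) // -weight_sqr // ler_pM ?sqr_ge0 //.
  - exact: posdef_qform_ge0.
  - by rewrite ler_sqr ?nnegrE ?weight_ge0 ?weight_le_c0 // ltW.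
  - by apply: qform_Hmat_mono; rewrite // (leq_trans (leq_pred _)).
rewrite (le_trans h1) //.
rewrite ler_wpM2r //.
have c2 : 0 <= c0 I ^+ 2 by apply: sqr_ge0.
nra.
Qed.

(* The estimate is compared with thS directly, without its first-order
   optimality condition: the Huber loss is quadratic between the residuals at
   thS and at th in every round whose rescaled noise is at most 2/3, and it lies
   above its tangent in the other rounds. *)
Lemma confidence_bound (rew : nat -> R) (T t : nat) (L B X : R)
    (th thS : 'cV[R]_d) :
  0 < c0 I -> (t <= T)%N -> 0 <= L -> 0 <= B ->
  norm2 th <= B -> norm2 thS <= B ->
  (forall s, (1 <= s <= T)%N -> norm2 (phi s) <= L) ->
  (forall s, (1 <= s <= T)%N -> rew s = dot (phi s) thS + noise s) ->
  (forall s, (1 <= s <= T)%N -> inv_tau s * (2 * L * B / sg s) <= 1 / 3) ->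
  9 / 4 * c0 I ^+ 2 * \sum_(1 <= s < T.+1) score s ^+ 2 <= 1 / 3 ->
  hoful_loss eps I phi rew nu t th <= hoful_loss eps I phi rew nu t thS ->
  wnorm (invmx (H t)) (score_sum t) <= X ->
  wnorm (H t) (th - thS) <= 3 * Num.sqrt (lambda I) * B + 3 * X.
Proof.
move=> c00 tT L0 B0 thB thSB phiL rewE small hc hmin hX.
set D := th - thS.
have pH : posdef (H t) by apply: Hmat_posdef.
have nD : norm2 D <= 2 * B.
  have h : norm2 D ^+ 2 <= (2 * B) ^+ 2.
    have e1 : dot th th = norm2 th ^+ 2 by rewrite norm2_sqr.
    have e2 : dot thS thS = norm2 thS ^+ 2 by rewrite norm2_sqr.
    have := dot_le_norm2 th thS; rewrite ler_norml => /andP[h1 _].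
    rewrite norm2_sqr /D dotDl !dotBr !dotNl [dot thS th]dotC e1 e2.
    have := norm2_ge0 th; have := norm2_ge0 thS; nra.
  by move: h; rewrite ler_sqr ?nnegrE ?norm2_ge0 ?mulr_ge0.
have rnd s : (1 <= s < t.+1)%N ->
  huber (tau eps I phi nu s) ((rew s - dot (phi s) thS) / sg s)
  - (score s / inv_tau s) * dot (x s) D
  + (1 / 2 * dot (x s) D ^+ 2 - 1 / 2 *
     (if `|inv_tau s * (noise s / sg s)| <= 2 / 3 then 0 else dot (x s) D ^+ 2))
  <= huber (tau eps I phi nu s) ((rew s - dot (phi s) th) / sg s).
  move=> /andP[s1 st]; have sT : (1 <= s <= T)%N by rewrite s1; exact: leq_trans tT.
  have sg0 : 0 < sg s by apply: sigma_gt0.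
  have yE : dot (x s) D = dot (phi s) D / sg s by rewrite /feature dotZl mulrC.
  have -> : (rew s - dot (phi s) thS) / sg s = noise s / sg s.
    by rewrite rewE // addrC addKr.
  have -> : (rew s - dot (phi s) th) / sg s = noise s / sg s - dot (x s) D.
    by rewrite rewE // yE /D dotBr; field; rewrite gt_eqF.
  have [w0|ws0] := eqVneq (w s) 0.
    rewrite (weight_eq0 lam0 w0) dot0l expr0n /= !(mulr0, subr0, addr0).
    by case: ifP; rewrite ?(mulr0, subr0, addr0).
  rewrite tauE // /score; have i0 := inv_tau_gt0 s1 ws0.
  have hy : `|inv_tau s * dot (x s) D| <= 1 / 3.
    rewrite normrM (gtr0_norm i0) (le_trans _ (small s sT)) //.
    rewrite ler_pM2l // yE normrM (gtr0_norm (_ : 0 < (sg s)^-1)) ?invr_gt0 //.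
    rewrite ler_pM2r ?invr_gt0 // (le_trans (dot_le_norm2 _ _)) //.
    rewrite (le_trans (ler_pM _ _ (phiL s sT) nD)) ?norm2_ge0 //.
    by rewrite mulrA [L * 2]mulrC.
  have := huber_lower (noise s / sg s) i0 hy; apply: le_trans.
  by rewrite lerD2l; case: ifP => _; lra.
have : \sum_(1 <= s < t.+1) (huber (tau eps I phi nu s) ((rew s - dot (phi s) thS) / sg s)
  - (score s / inv_tau s) * dot (x s) D
  + (1 / 2 * dot (x s) D ^+ 2 - 1 / 2 *
     (if `|inv_tau s * (noise s / sg s)| <= 2 / 3 then 0 else dot (x s) D ^+ 2)))
  <= \sum_(1 <= s < t.+1) huber (tau eps I phi nu s) ((rew s - dot (phi s) th) / sg s).
  exact: ler_sum_nat.
rewrite !big_split /= !sumrN -!mulr_sumr.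
have -> : \sum_(1 <= s < t.+1) score s / inv_tau s * dot (x s) D = dot (score_sum t) D.
  by rewrite /score_sum dot_suml; apply: eq_bigr => s _; rewrite dotZl.
have hbad := bad_rounds_le D c00 tT hc.
have hq := qform_Hmat I phi nu t D.
move: hmin; rewrite /hoful_loss !norm2_sqr.
have thE : th = thS + D by rewrite /D addrC subrK.
clearbody D; rewrite thE.
rewrite dotDl !dotDr [dot D thS]dotC.
rewrite !addrA.
set S1 := \sum_(_ <= _ < _) _ in hq *; set S2 := \sum_(_ <= _ < _) _ in hbad *.
have hq' := hq.
set q := qform (H t) D in hbad hq' *.
set T1 := \sum_(_ <= _ < _) _; set T2 := \sum_(_ <= _ < _) _.
move=> hmin hsum.
have q0 : 0 <= q by apply: posdef_qform_ge0.
have wq : wnorm (H t) D ^+ 2 = q by rewrite wnorm_sqr.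
(* The regularizer and all rounds together contribute q / 2, from which the rounds with large noise
   take at most q / 6. Dividing the resulting q / 3 by the norm of D produces the factor 3 in the
   radius. *)
have k1 : q / 3 <= dot (score_sum t) D - lambda I * dot thS D by lra.
have k2 : dot (score_sum t) D <= X * wnorm (H t) D.
  rewrite (le_trans (ler_norm _)) // (le_trans (dot_le_wnorm _ _ pH)) //.
  by rewrite ler_wpM2r ?wnorm_ge0.
have k3 : - (lambda I * dot thS D) <= Num.sqrt (lambda I) * B * wnorm (H t) D.
  have lD : Num.sqrt (lambda I) * norm2 D <= wnorm (H t) D.
    rewrite -ler_sqr ?nnegrE ?mulr_ge0 ?sqrtr_ge0 ?wnorm_ge0 //.
    rewrite wq exprMn sqr_sqrtr ?(ltW lam0) // norm2_sqr hq' lerDl.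
    by apply: sumr_ge0 => i _; apply: sqr_ge0.
  have : - dot thS D <= B * norm2 D.
    rewrite (le_trans (ler_norm _)) // normrN (le_trans (dot_le_norm2 _ _)) //.
    by rewrite ler_wpM2r ?norm2_ge0.
  move/(ler_wpM2l (ltW lam0)); rewrite mulrN => /le_trans; apply.
  have -> : lambda I * (B * norm2 D) = Num.sqrt (lambda I) * B * (Num.sqrt (lambda I) * norm2 D).
    by rewrite -{1}(sqr_sqrtr (ltW lam0)); ring.
  by rewrite ler_wpM2l // mulr_ge0 ?sqrtr_ge0.
have [->|Wn0] := eqVneq (wnorm (H t) D) 0.
  rewrite addr_ge0 ?mulr_ge0 ?sqrtr_ge0 //.
  by rewrite (le_trans (wnorm_ge0 _ _) hX).
have W0 : 0 < wnorm (H t) D by rewrite lt_neqAle eq_sym Wn0 wnorm_ge0.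
rewrite -(ler_pM2r W0) -expr2 wq; lra.
Qed.

End Scores.

Lemma sum_CauchySchwarz (R : realType) (T : nat) (u v : nat -> R) :
  \sum_(1 <= t < T.+1) u t * v t <=
  Num.sqrt (\sum_(1 <= t < T.+1) u t ^+ 2) * Num.sqrt (\sum_(1 <= t < T.+1) v t ^+ 2).
Proof.
pose U : 'cV[R]_T := \col_i u i.+1; pose V : 'cV[R]_T := \col_i v i.+1.
have := le_trans (ler_norm _) (dot_le_norm2 U V).
have e f g : dot (\col_i f i.+1 : 'cV[R]_T) (\col_i g i.+1)
    = \sum_(1 <= t < T.+1) f t * g t.
  by rewrite dotE big_add1 big_mkord; apply: eq_bigr => i _; rewrite !mxE.
by rewrite /norm2 !e.
Qed.

(** * Regret *)

Section Regret.
Variables (R : realType) (d : nat) (I : hoful_input R).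
Variables (phi : nat -> 'cV[R]_d) (nu : nat -> R).
Hypotheses (lam0 : 0 < lambda I) (smin0 : 0 < sigma_min I) (d0 : (0 < d)%N).
Hypotheses (c00 : 0 < c0 I) (c01 : c0 I <= 1) (tau00 : 0 < tau0 I).
Hypotheses (L0 : 0 < arm_bound I) (B0 : 0 < param_bound I).
Hypotheses (c10 : 0 < c1 I) (kap0 : 0 < kappa d I).
Hypothesis c1E : 48 * (c1 I * (2 * kappa d I)) = tau0 I ^+ 2.
Hypothesis phi_le : forall s, (1 <= s <= horizon I)%N -> norm2 (phi s) <= arm_bound I.

Local Notation H := (Hmat I phi nu).
Local Notation sg := (sigma I phi nu).
Local Notation w := (weight I phi nu).
Local Notation LB := (arm_bound I * param_bound I).
Local Notation nphi s := (wnorm (invmx (H s.-1)) (phi s)).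

(** The denominator of the last entry of the maximum in sigma_t. By [c1E], Y^4 = tau_0^2 / 48, so
    Y^2 lies between tau_0 / 7 and tau_0 / 6, as 6^2 < 48 < 7^2. *)
Let Y : R := c1 I `^ 4^-1 * (2 * kappa d I) `^ 4^-1.

Let Y_gt0 : 0 < Y.
Proof. by rewrite /Y mulr_gt0 ?powR_gt0 // mulr_gt0. Qed.

Let Y4 : 48 * (Y ^+ 2) ^+ 2 = tau0 I ^+ 2.
Proof.
have pw z : 0 < z -> (z `^ 4^-1) ^+ 4 = z.
  by move=> z0; rewrite -powR_mulrn ?powR_ge0 // -powRrM mulVf // powRr1 // ltW.
by rewrite -c1E -exprM -[(2 * 2)%N]/4%N /Y exprMn !pw // mulr_gt0.
Qed.

Let Y2_le : Y ^+ 2 <= tau0 I / 6.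
Proof.
have := Y4; have : 0 <= Y ^+ 2 by apply: sqr_ge0.
move: (Y ^+ 2) => Z Z0 ZE; apply: sqr_le_imp; first by rewrite divr_ge0 // ltW.
by rewrite exprMn -ZE; have := sqr_ge0 Z; lra.
Qed.

Let Y2_ge : tau0 I / 7 <= Y ^+ 2.
Proof.
have := Y4; have : 0 <= Y ^+ 2 by apply: sqr_ge0.
move: (Y ^+ 2) => Z Z0 ZE; apply: sqr_le_imp; nra.
Qed.

(** The last entry of the maximum in sigma_s exists for this bound. It gives L B |phi_s| <= Y^2
    sigma_s^2 in the norm of H_{s-1}^{-1}, with Y^2 <= tau_0 / 6. Since 2 L B / sigma_s bounds the
    change of a residual when the parameter moves inside its ball, such a change stays within a
    third of the threshold. *)
Lemma small_feature (eps : R) s : 0 < eps <= 1 -> (0 < s)%N ->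
  inv_tau I eps phi nu s * (2 * arm_bound I * param_bound I / sg s) <= 1 / 3.
Proof.
move=> eps01 s0; have sg0 : 0 < sg s by apply: sigma_gt0.
have h : Num.sqrt LB / Y * Num.sqrt (nphi s) <= sg s.
  by rewrite /sigma /sigma_step !le_max lexx !orbT.
have h2 : LB / Y ^+ 2 * nphi s <= sg s ^+ 2.
  have : (Num.sqrt LB / Y * Num.sqrt (nphi s)) ^+ 2 <= sg s ^+ 2.
    by rewrite ler_sqr ?nnegrE ?(ltW sg0) // !mulr_ge0 ?sqrtr_ge0 ?invr_ge0 ?(ltW Y_gt0).
  have LB0 : 0 <= LB by rewrite mulr_ge0 // ltW.
  by rewrite exprMn [(_ / Y) ^+ 2]exprMn exprVn (sqr_sqrtr LB0) (sqr_sqrtr (wnorm_ge0 _ _)).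
have wE : w s * sg s = nphi s by rewrite weightE // mulrC mulVKf // gt_eqF.
have h3 : LB * nphi s <= tau0 I / 6 * sg s ^+ 2.
  have : LB * nphi s <= Y ^+ 2 * sg s ^+ 2.
    by rewrite -ler_pdivrMl ?exprn_gt0 // mulrA [_^-1 * _]mulrC.
  by move/le_trans; apply; apply: ler_wpM2r; [exact: sqr_ge0|exact: Y2_le].
have s1 : 1 <= (s%:R : R) `^ rate eps.
  have := pow_rate_mono eps01 s0; by rewrite powR1.
have h4 : inv_tau I eps phi nu s <= w s / tau0 I.
  apply: (le_trans (y := w s / (tau0 I * s%:R `^ rate eps))); first exact: inv_tau_le.
  rewrite ler_wpM2l ?weight_ge0 // lef_pV2 ?posrE ?mulr_gt0 //; last by lra.
  by rewrite ler_peMr // ltW.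
have q0 : 0 <= 2 * arm_bound I * param_bound I / sg s.
  by rewrite divr_ge0 ?mulr_ge0 ?(ltW L0) ?(ltW B0) // ltW.
rewrite (le_trans (ler_wpM2r q0 h4)) //.
rewrite (_ : w s / tau0 I * _ = 2 * (LB * nphi s) / (tau0 I * sg s ^+ 2)); last first.
  by rewrite -wE; field; rewrite !gt_eqF.
rewrite ler_pdivrMr ?mulr_gt0 ?exprn_gt0 //; nra.
Qed.

Lemma nphi_le s : (1 <= s <= horizon I)%N -> nphi s <= arm_bound I / Num.sqrt (lambda I).
Proof.
move=> sT; have pH := Hmat_posdef phi nu lam0 s.-1.
have hl y : lambda I * dot y y <= qform (H s.-1) y.
  by rewrite qform_Hmat lerDl; apply: sumr_ge0 => i _; apply: sqr_ge0.
have := qform_inv_le (phi s) pH lam0 hl.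
rewrite -norm2_sqr => h.
rewrite -ler_sqr ?nnegrE ?wnorm_ge0 ?divr_ge0 ?sqrtr_ge0 ?(ltW L0) //.
rewrite wnorm_sqr ?posdef_qform_ge0 //; last exact: posdef_inv.
rewrite (le_trans h) // (_ : (_ / _) ^+ 2 = arm_bound I ^+ 2 / lambda I); last first.
  by rewrite exprMn exprVn sqr_sqrtr // ltW.
rewrite ler_wpM2r ?invr_ge0 ?(ltW lam0) // ler_sqr ?nnegrE ?norm2_ge0 ?(ltW L0) //.
exact: phi_le.
Qed.

(* Each round is charged to the term that realizes the maximum in sigma_t. *)
Lemma nphi_charge s : (1 <= s <= horizon I)%N -> 0 <= nu s ->
  nphi s <= nu s * w s + sigma_min I * w s +
    (arm_bound I / Num.sqrt (lambda I) / c0 I ^+ 2 + 7 * LB / tau0 I) * w s ^+ 2.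
Proof.
move=> sT nu0; have sg0 : 0 < sg s by apply: sigma_gt0.
have wE : sg s * w s = nphi s by rewrite weightE // mulVKf // gt_eqF.
have w0 : 0 <= w s by apply: weight_ge0.
set M := arm_bound I / _.
have M0 : 0 <= M by rewrite divr_ge0 ?sqrtr_ge0 // ltW.
have LB0 : 0 < LB by rewrite mulr_gt0.
set t1 := nu s * w s; set t2 := sigma_min I * w s.
rewrite mulrDl; set t3 := M / _ * _; set t4 := 7 * _ / _ * _.
have t10 : 0 <= t1 by rewrite mulr_ge0.
have t20 : 0 <= t2 by rewrite mulr_ge0 // ltW.
have t30 : 0 <= t3 by apply: mulr_ge0; [apply: divr_ge0 => //|]; exact: sqr_ge0.
have t40 : 0 <= t4 by rewrite mulr_ge0 ?divr_ge0 ?mulr_ge0 ?sqr_ge0 // ltW.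
have n0 : 0 <= nphi s by apply: wnorm_ge0.
have : [|| sg s == nu s, sg s == sigma_min I, sg s == nphi s / c0 I
     | sg s == Num.sqrt LB / Y * Num.sqrt (nphi s)].
  rewrite /sigma /sigma_step -/Y.
  set e1 := nu s; set e2 := sigma_min I; set e3 := _ / c0 I; set e4 := _ * Num.sqrt (nphi s).
  have mx (p q : R) : Num.max p q = p \/ Num.max p q = q by case: (leP p q); [right|left].
  case: (mx e1 (Num.max e2 (Num.max e3 e4))) => ->; rewrite ?eqxx //.
  case: (mx e2 (Num.max e3 e4)) => ->; rewrite ?eqxx ?orbT //.
  by case: (mx e3 e4) => ->; rewrite eqxx ?orbT.
case/or4P => /eqP sE.
- have : nphi s = t1 by rewrite -wE sE.
  lra.
- have : nphi s = t2 by rewrite -wE sE.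
  lra.
- suff : nphi s <= t3 by lra.
  have [->//|nn0] := eqVneq (nphi s) 0.
  have np : 0 < nphi s by rewrite lt_neqAle eq_sym nn0.
  (* The weight equals its cap, so [t3] is the uniform bound [M] on the norm. *)
  have wc : w s = c0 I.
    by rewrite weightE // sE invf_div -mulrA mulVf ?mulr1 // gt_eqF.
  by rewrite /t3 wc -mulrA mulVf ?mulr1 ?nphi_le // gt_eqF // exprn_gt0.
- suff : nphi s <= t4 by lra.
  have [->//|nn0] := eqVneq (nphi s) 0.
  have np : 0 < nphi s by rewrite lt_neqAle eq_sym nn0.
  have s2 : sg s ^+ 2 = LB / Y ^+ 2 * nphi s.
    by rewrite sE exprMn [(_ / Y) ^+ 2]exprMn exprVn (sqr_sqrtr (ltW LB0)) (sqr_sqrtr n0).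
  (* Here w_s^2 is proportional to the norm itself, and [Y2_ge] bounds the factor from below. *)
  have w2 : w s ^+ 2 = nphi s * Y ^+ 2 / LB.
    have -> : w s = nphi s / sg s by rewrite -wE mulrAC mulfV ?mul1r // gt_eqF.
    rewrite exprMn exprVn s2; field; rewrite !gt_eqF //.
  rewrite /t4 w2 (_ : 7 * LB / _ * _ = nphi s * (7 * Y ^+ 2 / tau0 I)); last first.
    by field; rewrite !gt_eqF.
  by rewrite ler_peMr // ler_pdivlMr // mul1r -ler_pdivrMl // mulrC; exact: Y2_ge.
Qed.

Lemma sum_nphi_le : (forall s, (1 <= s <= horizon I)%N -> 0 <= nu s) ->
  \sum_(1 <= s < (horizon I).+1) nphi s <=
  Num.sqrt (2 * kappa d I) * Num.sqrt (\sum_(1 <= s < (horizon I).+1) nu s ^+ 2)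
  + Num.sqrt (2 * kappa d I) * Num.sqrt ((horizon I)%:R * sigma_min I ^+ 2)
  + (arm_bound I / Num.sqrt (lambda I) / c0 I ^+ 2 + 7 * LB / tau0 I) * (2 * kappa d I).
Proof.
move=> nu0; set T := horizon I.
have sw := sum_weight_sqr nu lam0 smin0 phi_le d0 c00 c01 (leqnn T).
set K := _ + 7 * LB / _.
have K0 : 0 <= K.
  rewrite addr_ge0 ?divr_ge0 ?mulr_ge0 ?sqrtr_ge0 ?sqr_ge0 //; by rewrite ltW.
have h : \sum_(1 <= s < T.+1) nphi s <= \sum_(1 <= s < T.+1)
   (nu s * w s + sigma_min I * w s + K * w s ^+ 2).
  by apply: ler_sum_nat => s sT; apply: nphi_charge => //; apply: nu0.
rewrite (le_trans h) // !big_split /= -!mulr_sumr.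
have G : Num.sqrt (\sum_(1 <= s < T.+1) w s ^+ 2) <= Num.sqrt (2 * kappa d I).
  exact: ler_wsqrtr.
rewrite !lerD //.
- rewrite (le_trans (sum_CauchySchwarz T nu w)) // mulrC ler_wpM2r // sqrtr_ge0.
- rewrite mulr_sumr (le_trans (sum_CauchySchwarz T (fun=> sigma_min I) w)) //.
  by rewrite mulrC sumr_const_nat subn1 /= -[sigma_min I ^+ 2 *+ T]mulr_natl ler_wpM2r // sqrtr_ge0.
- exact: ler_wpM2l.
Qed.

Lemma regret_le_sum (D : nat -> set 'cV[R]_d) (theta_star : 'cV[R]_d)
    (phi_star theta : nat -> 'cV[R]_d) (eps b : R) (rew : nat -> R) :
  norm2 theta_star <= param_bound I ->
  (forall t, (1 <= t <= horizon I)%N ->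
     is_maximizer (D t) (fun x => dot x theta_star) (phi_star t)) ->
  heavy_oful_run eps I D phi rew nu theta ->
  Num.sqrt (lambda I) * param_bound I <= b ->
  (forall t, (1 <= t <= horizon I)%N -> beta I t <= b) ->
  (forall t, (1 <= t <= horizon I)%N ->
     wnorm (H t) (theta t - theta_star) <= beta I t) ->
  regret (horizon I) theta_star phi_star phi
  <= 2 * b * \sum_(1 <= s < (horizon I).+1) nphi s.
Proof.
move=> nS maxS run lb bb conf; rewrite /regret mulr_sumr.
apply: ler_sum_nat => t /andP[t1 tT].
have tI : (1 <= t <= horizon I)%N by rewrite t1.
have tT' : (t.-1 <= horizon I)%N by rewrite (leq_trans (leq_pred _)).
have [th [[/= Dphi Cth] mx]] := optimistic_choice run tI.
have pH := Hmat_posdef phi nu lam0 t.-1.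
have cS : conf_set I phi nu theta t.-1 theta_star.
  rewrite /conf_set; case: eqVneq => [_|n0] //=.
  have -> : theta_star - theta t.-1 = (-1) *: (theta t.-1 - theta_star).
    by rewrite scaleN1r opprB.
  rewrite /wnorm -/(qform _ _) qformZ sqrrN expr1n mul1r.
  by apply: conf; rewrite lt0n n0.
have := mx (phi_star t, theta_star) (conj (proj1 (maxS t tI)) cS) => /= h1.
rewrite (le_trans (lerB h1 (lexx _))) //.
have n0 : 0 <= nphi t by apply: wnorm_ge0.
have dphi y : dot (phi t) y <= nphi t * wnorm (H t.-1) y.
  exact: le_trans (ler_norm _) (dot_le_wnorm _ _ pH).
have dphiN y : - dot (phi t) y <= nphi t * wnorm (H t.-1) y.
  rewrite (le_trans (ler_norm _)) // normrN; exact: dot_le_wnorm.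
(* In round 1 the confidence set is the parameter ball and H_0 is lambda times the identity; [lb]
   makes b large enough for this case too. *)
rewrite -dotBr; move: Cth; rewrite /conf_set; case: eqVneq => [t0|t0] /= Cth.
  have w0 y : norm2 y <= param_bound I -> wnorm (H t.-1) y <= b.
    move=> hy; rewrite (le_trans _ lb) // t0 /wnorm -/(qform _ _) qform_scalar.
    by rewrite sqrtrM ?(ltW lam0) // ler_wpM2l ?sqrtr_ge0.
  rewrite dotBr.
  have := ler_wpM2l n0 (w0 _ Cth); have := ler_wpM2l n0 (w0 _ nS).
  have := dphi th; have := dphiN theta_star; lra.
have t1I : (1 <= t.-1 <= horizon I)%N by rewrite lt0n t0.
have -> : th - theta_star = (th - theta t.-1) + (theta t.-1 - theta_star).
  by rewrite addrA subrK.
rewrite dotDr.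
have := ler_wpM2l n0 (le_trans Cth (bb _ t1I)).
have := ler_wpM2l n0 (le_trans (conf _ t1I) (bb _ t1I)).
have := dphi (th - theta t.-1); have := dphi (theta t.-1 - theta_star); lra.
Qed.

End Regret.

(** * Tuning *)

Section Tuning.
Variables (R : realType) (d T : nat) (L B eps delta : R).
Hypotheses (L0 : 0 < L) (B0 : 0 < B) (d0 : (0 < d)%N) (T0 : (0 < T)%N).
Hypotheses (eps01 : 0 < eps <= 1) (delta01 : 0 < delta < 1).

Local Notation I := (tuned_input d T L B eps delta).
Local Notation lg := (ln (2 * T%:R ^+ 2 / delta)).
Local Notation l3 := (ln (3 * T%:R) : R).
Local Notation a := (rate eps).
Local Notation kap := (kappa d I).

Let dR : 0 < d%:R :> R. Proof. by rewrite ltr0n. Qed.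
Let d1 : 1 <= d%:R :> R. Proof. by rewrite ler1n. Qed.
Let TR : 0 < T%:R :> R. Proof. by rewrite ltr0n. Qed.
Let T1 : 1 <= T%:R :> R. Proof. by rewrite ler1n. Qed.
Let de0 : 0 < delta. Proof. by case/andP: delta01. Qed.
Let de1 : delta < 1. Proof. by case/andP: delta01. Qed.
Let e0 : 0 < eps. Proof. by case/andP: eps01. Qed.

Lemma lgE : lg = ln 2 + 2 * ln T%:R + ln delta^-1.
Proof.
by rewrite lnM ?posrE ?invr_gt0 ?mulr_gt0 ?exprn_gt0 // lnM ?posrE ?exprn_gt0 // lnXn // mulr_natl.
Qed.

Lemma ln_T_ge0 : 0 <= ln T%:R :> R. Proof. exact: ln_ge0. Qed.

Lemma ln_deltaV_ge0 : 0 <= ln delta^-1.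
Proof. by rewrite ln_ge0 // invf_ge1 // ltW. Qed.

Lemma lg_ge_half : 1 / 2 <= lg.
Proof.
by rewrite lgE; have := @ln2_ge_half R; have := ln_T_ge0; have := ln_deltaV_ge0; lra.
Qed.

Let lg0 : 0 < lg. Proof. by have := lg_ge_half; lra. Qed.

Lemma l3E : l3 = ln 3 + ln T%:R.
Proof. by rewrite lnM ?posrE. Qed.

Lemma l3_ge1 : 1 <= l3.
Proof. by rewrite l3E; have := ln3_ge1 R; have := ln_T_ge0; lra. Qed.

Let l30 : 0 < l3. Proof. by have := l3_ge1; lra. Qed.

Lemma tuned_lambda_gt0 : 0 < lambda I.
Proof. by rewrite /= divr_gt0 ?exprn_gt0. Qed.

Lemma tuned_sigma_min_gt0 : 0 < sigma_min I.
Proof. by rewrite /= divr_gt0 ?sqrtr_gt0. Qed.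

Lemma tuned_sigma_min_sqr : T%:R * sigma_min I ^+ 2 = 1.
Proof. by rewrite /= div1r exprVn sqr_sqrtr ?ler0n // mulfV // gt_eqF. Qed.

Lemma tuned_kappaE : kap = d%:R * ln (1 + T%:R ^+ 2 * (L * B) ^+ 2 / d%:R ^+ 2).
Proof.
rewrite /kappa /kappa_of /=; congr (_ * ln (1 + _)).
rewrite div1r exprVn sqr_sqrtr ?ler0n //; field; rewrite !gt_eqF //.
Qed.

Lemma tuned_kappa_gt0 : 0 < kap.
Proof.
rewrite tuned_kappaE mulr_gt0 // ln_gt0 // ltrDl divr_gt0 ?mulr_gt0 ?exprn_gt0 //.
Qed.

Lemma tuned_c0_gt0 : 0 < c0 I.
Proof. by rewrite /= divr_gt0 ?sqrtr_gt0 ?mulr_gt0. Qed.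

Lemma tuned_c0_sqr : c0 I ^+ 2 = (23 * lg)^-1.
Proof. by rewrite /= div1r exprVn sqr_sqrtr // mulr_ge0 // ltW. Qed.

Lemma tuned_c0_le1 : c0 I <= 1.
Proof.
apply: sqr_le_imp => //; rewrite tuned_c0_sqr expr1n invf_le1 ?mulr_gt0 //.
by have := lg_ge_half; lra.
Qed.

Lemma tuned_c1_gt0 : 0 < c1 I.
Proof. by rewrite /= divr_gt0 ?powR_gt0 ?mulr_gt0 ?powR_gt0. Qed.

Lemma tuned_tau0_gt0 : 0 < tau0 I.
Proof.
by rewrite /= divr_gt0 ?powR_gt0 // mulr_gt0 ?powR_gt0 // sqrtr_gt0 mulr_gt0 // tuned_kappa_gt0.
Qed.

Let e1n0 : 1 + eps != 0. Proof. by rewrite gt_eqF // addr_gt0. Qed.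

Lemma tuned_c1E : 48 * (c1 I * (2 * kap)) = tau0 I ^+ 2.
Proof.
have k0 : 0 <= 2 * kap by rewrite mulr_ge0 // ltW // tuned_kappa_gt0.
rewrite /= -/kap.
have sq z p : (z `^ p) ^+ 2 = z `^ (2 * p).
  by rewrite mulrC powRrM powR_mulrn ?powR_ge0.
rewrite !exprMn exprVn sqr_sqrtr // !sq.
have -> : 2 * ((1 - eps) / (2 * (1 + eps))) = (1 - eps) / (1 + eps) by field.
have -> : 2 * (1 / (1 + eps)) = 2 / (1 + eps) by field.
by field; rewrite gt_eqF ?powR_gt0.
Qed.

Lemma tuned_tau0_lg :
  tau0 I * lg = Num.sqrt (2 * kap) * l3 `^ a * lg `^ (eps / (1 + eps)).
Proof.
rewrite /= -/a -/kap.
have -> : eps / (1 + eps) = 1 - 1 / (1 + eps) by field.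
rewrite powRB ?powRr1 ?(ltW lg0) ?(gt_eqF lg0) ?implybT //; field.
by rewrite gt_eqF ?powR_gt0.
Qed.

(** The radius is what [confidence_bound] yields when X is the bound of [score_sum_bound]; its
    constant 24 is 3 * 8. *)
Lemma tuned_betaE t : beta I t
  = 3 * Num.sqrt (lambda I) * B + 3 * (8 * tau0 I * t%:R `^ a * lg).
Proof.
have -> : 8 * tau0 I * t%:R `^ a * lg = 8 * t%:R `^ a * (tau0 I * lg) by ring.
by rewrite tuned_tau0_lg /= -/a -/kap; ring.
Qed.

(** The sum of the compensators. The elliptical potential supplies W = 2 kappa, and ln (3 T) >= 1 +
    ln T dominates the harmonic sum. *)
Lemma tuned_sum_inv_tau (phi : nat -> 'cV[R]_d) (nu : nat -> R) :
  (forall s, (1 <= s <= T)%N -> norm2 (phi s) <= L) ->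
  \sum_(1 <= s < T.+1) inv_tau I eps phi nu s `^ (1 + eps) <= lg.
Proof.
move=> phiL; have lam0 := tuned_lambda_gt0; have sm0 := tuned_sigma_min_gt0.
have W0 : 0 < 2 * kap by rewrite mulr_gt0 // tuned_kappa_gt0.
have w0 s : 0 <= weight I phi nu s by apply: weight_ge0.
have r1 s : 1 <= Num.sqrt (1 + weight I phi nu s ^+ 2).
  by rewrite -[leLHS]sqrtr1 ler_wsqrtr // lerDl sqr_ge0.
have q0 s : 0 <= weight I phi nu s / Num.sqrt (1 + weight I phi nu s ^+ 2).
  by rewrite divr_ge0 // sqrtr_ge0.
have hh : \sum_(1 <= s < T.+1) (s%:R : R)^-1 <= l3.
  rewrite (le_trans (harmonic_le R T0)) // l3E lerD2r ln3_ge1 //.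
apply: (sum_powR_tuned eps01 W0 l30 lg0 q0 _ hh).
have := sum_weight_sqr nu lam0 sm0 phiL d0 tuned_c0_gt0 tuned_c0_le1 (leqnn T).
apply: le_trans; apply: ler_sum => s _; rewrite ler_sqr ?nnegrE //.
by rewrite ler_pdivrMr ?(lt_le_trans ltr01) // ler_peMr.
Qed.

Local Notation LF := (log_factor d T delta).
Local Notation cLB := (2 + (L * B) ^+ 2).

Lemma log_factor_ge1 : 1 <= LF.
Proof.
have := ln_T_ge0; have := ln_deltaV_ge0; have : 0 <= ln d%:R :> R by exact: ln_ge0.
by rewrite /log_factor; lra.
Qed.

Lemma lnT_le_log_factor : 2 * ln T%:R + ln delta^-1 + 2 <= 2 * LF.
Proof.
have := ln_T_ge0; have := ln_deltaV_ge0; have : 0 <= ln d%:R :> R by exact: ln_ge0.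
by rewrite /log_factor; lra.
Qed.

Lemma lg_le : lg <= 2 * LF.
Proof. by rewrite lgE; have := lnT_le_log_factor; have := @ln_le_B1 R 2 (ltr0n _ 2); lra. Qed.

(** [lg] may be below 1, where lowering the exponent increases the power; so the base is first
    raised to 2 [LF] >= 1. *)
Lemma lg_powR_le p : 0 <= p <= 1 -> lg `^ p <= 2 * LF.
Proof.
move=> /andP[p0 p1]; have F1 := log_factor_ge1.
rewrite (le_trans (_ : _ <= (2 * LF) `^ p)) //.
  by rewrite ge0_ler_powR ?nnegrE ?lg_le ?(ltW lg0) // mulr_ge0 //; lra.
by rewrite ler1_powR //; lra.
Qed.

Lemma l3_powR_le : l3 `^ a <= 2 * LF.
Proof.
rewrite (le_trans (ler1_powR l3_ge1 (rate_le1 eps01))) // l3E.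
have := @ln_le_B1 R 3 (ltr0n _ 3); have := ln_T_ge0; have := ln_deltaV_ge0.
by have := lnT_le_log_factor; lra.
Qed.

Lemma tuned_kappa_le : kap <= d%:R * (cLB * LF).
Proof.
rewrite tuned_kappaE ler_pM2l //.
have T2 : 1 <= (T%:R : R) ^+ 2 by rewrite exprn_ege1.
have M0 : 0 <= (L * B) ^+ 2 by apply: sqr_ge0.
have d2 : 0 < (d%:R : R) ^+ 2 by rewrite exprn_gt0.
have h : 1 + T%:R ^+ 2 * (L * B) ^+ 2 / d%:R ^+ 2 <= T%:R ^+ 2 * (1 + (L * B) ^+ 2).
  rewrite mulrDr mulr1 lerD // ler_pdivrMr // ler_peMr ?exprn_ege1 //.
  by apply: mulr_ge0; exact: sqr_ge0.
have h0 : 0 < 1 + T%:R ^+ 2 * (L * B) ^+ 2 / d%:R ^+ 2.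
  rewrite ltr_pwDl // divr_ge0 ?(ltW d2) //.
  by apply: mulr_ge0 => //; exact: sqr_ge0.
have h1 : 0 < 1 + (L * B) ^+ 2 by rewrite ltr_pwDl.
rewrite (le_trans (_ : _ <= ln (T%:R ^+ 2 * (1 + (L * B) ^+ 2)))) //.
  by rewrite ler_ln ?posrE // mulr_gt0 // exprn_gt0.
rewrite lnM ?posrE ?exprn_gt0 // lnXn // -[ln _ *+ 2]mulr_natl.
have := ln_le_B1 h1; rewrite addrAC subrr add0r => h2.
have F1 := log_factor_ge1.
have := lnT_le_log_factor; have := ln_deltaV_ge0.
have : (L * B) ^+ 2 <= (L * B) ^+ 2 * LF by rewrite ler_peMr.
lra.
Qed.

Lemma sqrt_kappa_le : Num.sqrt (2 * kap) <= Num.sqrt d%:R * (2 * cLB * LF).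
Proof.
have F1 := log_factor_ge1; have c2 : 2 <= cLB by rewrite lerDl sqr_ge0.
have k0 := tuned_kappa_gt0.
have cF : 1 <= cLB * LF by rewrite (le_trans (_ : 1 <= 2 * 1)) // ?ler_pM //; lra.
apply: sqr_le_imp; first by rewrite mulr_ge0 ?sqrtr_ge0 // -mulrA mulr_ge0 //; lra.
rewrite exprMn !sqr_sqrtr ?ler0n //; last by rewrite mulr_ge0 // ltW.
have -> : (2 * cLB * LF) ^+ 2 = 4 * (cLB * LF) ^+ 2 by ring.
have := tuned_kappa_le; set z := cLB * LF in cF * => h.
have : d%:R * z <= d%:R * z ^+ 2 by rewrite ler_pM2l // ler_eXnr.
have : 0 <= d%:R * z by rewrite mulr_ge0 //; lra.
lra.
Qed.

(** With F = [LF], beta_T is at most a multiple of sqrt d T^a F^3, and the sum of the norms at most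
    a multiple of sqrt d F^2 (S + 1): hence d and F^5. Among the constants, 192 = 24 * 2^3 comes
    from the radius, and 120 = 92 + 28 from the rounds where one of the last two entries of the
    maximum in sigma_t is attained. *)
Lemma tuned_regret_bound (S : R) : 0 <= S ->
  2 * beta I T * (Num.sqrt (2 * kap) * S
     + Num.sqrt (2 * kap) * Num.sqrt (T%:R * sigma_min I ^+ 2)
     + (L / Num.sqrt (lambda I) / c0 I ^+ 2 + 7 * (L * B) / tau0 I) * (2 * kap))
  <= 2 * (3 + 192 * cLB) * (2 * cLB + 120 * cLB * (L * B)) * LF ^+ 5
     * (d%:R * T%:R `^ a * S + d%:R * T%:R `^ a).
Proof.
move=> S0; have F1 := log_factor_ge1; have c2 : 2 <= cLB by rewrite lerDl sqr_ge0.
have k0 := tuned_kappa_gt0; have kle := tuned_kappa_le; have Gle := sqrt_kappa_le.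
have G2 : Num.sqrt (2 * kap) ^+ 2 = 2 * kap by rewrite sqr_sqrtr // mulr_ge0 // ltW.
have lamE : Num.sqrt (lambda I) = Num.sqrt d%:R / B.
  by rewrite /= sqrtrM // sqrtrV ?sqr_ge0 // sqrtr_sqr gtr0_norm.
have A1 : 1 <= (T%:R : R) `^ a.
  by have := pow_rate_mono eps01 T0; rewrite powR1.
have p1 : 0 <= 1 / (1 + eps) <= 1.
  by rewrite divr_ge0 ?addr_ge0 ?(ltW e0) //= ler_pdivrMr ?mul1r ?lerDl ?(ltW e0) // addr_gt0.
have p2 : 0 <= eps / (1 + eps) <= 1.
  by rewrite divr_ge0 ?addr_ge0 ?(ltW e0) //= ler_pdivrMr ?mul1r ?lerDr // addr_gt0.
have u1 := lg_powR_le p1; have u2 := lg_powR_le p2; have u3 := l3_powR_le.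
have l3p : 1 <= l3 `^ a by rewrite -[leLHS](powRr0 l3) ler_powR ?l3_ge1 ?rate_ge0.
have tauE' : 2 * kap / tau0 I = Num.sqrt (2 * kap) * lg `^ (1 / (1 + eps)) / l3 `^ a.
  have G0 : 0 < Num.sqrt (2 * kap) by rewrite sqrtr_gt0 mulr_gt0.
  rewrite /= -/a -/kap -{1}G2; field.
  by rewrite !gt_eqF ?powR_gt0 //.
have bE : beta I T = 3 * Num.sqrt d%:R
   + 24 * T%:R `^ a * Num.sqrt (2 * kap) * l3 `^ a * lg `^ (eps / (1 + eps)).
  rewrite /= -/a -/kap -[Num.sqrt (d%:R / B ^+ 2)]/(Num.sqrt (lambda I)) lamE.
  by rewrite -[3 * _ * B]mulrA divfK // gt_eqF.
have q0 : 0 < Num.sqrt d%:R :> R by rewrite sqrtr_gt0.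
have qq : Num.sqrt d%:R ^+ 2 = d%:R :> R by rewrite sqr_sqrtr // ler0n.
have lgle := lg_le.
have lgn := ltW lg0.
have M0 : 0 < L * B by rewrite mulr_gt0.
rewrite tuned_sigma_min_sqr sqrtr1 mulr1.
set G := Num.sqrt (2 * kap) in Gle G2 tauE' bE *.
have G0 : 0 <= G by apply: sqrtr_ge0.
rewrite lamE tuned_c0_sqr invrK.
set q := Num.sqrt d%:R in q0 qq Gle lamE bE *.
set A := T%:R `^ a in A1 bE *.
set F := LF in F1 Gle kle u1 u2 u3 lgle *.
set c := cLB in c2 Gle kle *.
set M := L * B in M0 *.
have b0 : beta I T <= q * A * (3 + 192 * c) * F ^+ 3.
  rewrite bE.
  have h1 : 3 * q <= q * A * 3 * F ^+ 3.
    have -> : q * A * 3 * F ^+ 3 = (3 * q) * (A * F ^+ 3) by ring.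
    rewrite ler_peMr ?mulr_ge0 ?(ltW q0) //.
    by rewrite -[leLHS]mulr1 ler_pM ?exprn_ege1.
  have h2 : 24 * A * G * l3 `^ a * lg `^ (eps / (1 + eps))
     <= 24 * A * (q * (2 * c * F)) * (2 * F) * (2 * F).
    rewrite ler_pM ?mulr_ge0 ?powR_ge0 // ler_pM ?mulr_ge0 ?powR_ge0 //.
    by rewrite ler_wpM2l // mulr_ge0 ?powR_ge0.
  have -> : q * A * (3 + 192 * c) * F ^+ 3
    = q * A * 3 * F ^+ 3 + 24 * A * (q * (2 * c * F)) * (2 * F) * (2 * F) by ring.
  exact: lerD.
have b1 : 0 <= beta I T.
  rewrite bE addr_ge0 ?mulr_ge0 ?powR_ge0 // ltW //.
have r1 : L / (q / B) * (23 * lg) * (2 * kap) <= 92 * c * M * q * F ^+ 2.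
  have -> : L / (q / B) * (23 * lg) * (2 * kap) = 46 * (M / q) * (lg * kap).
    by rewrite /M; field; rewrite !gt_eqF.
  have : lg * kap <= 2 * F * (q ^+ 2 * (c * F)) by rewrite qq ler_pM // ltW.
  move/(ler_wpM2l (_ : 0 <= 46 * (M / q))) => /(_ _)/le_trans; apply.
    by rewrite mulr_ge0 // divr_ge0 // ltW.
  rewrite le_eqVlt; apply/orP; left; apply/eqP; field; by rewrite gt_eqF.
have r2 : 7 * M / tau0 I * (2 * kap) <= 28 * c * M * q * F ^+ 2.
  have -> : 7 * M / tau0 I * (2 * kap) = 7 * M * (2 * kap / tau0 I) by ring.
  rewrite tauE'.
  have : G * lg `^ (1 / (1 + eps)) / l3 `^ a <= q * (2 * c * F) * (2 * F).
    rewrite ler_pdivrMr ?powR_gt0 // -[leLHS]mulr1 ler_pM ?mulr_ge0 ?powR_ge0 //.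
    by rewrite ler_pM ?powR_ge0.
  move/(ler_wpM2l (_ : 0 <= 7 * M)) => /(_ _)/le_trans; apply.
    by rewrite mulr_ge0 // ltW.
  by rewrite le_eqVlt; apply/orP; left; apply/eqP; ring.
rewrite [(_ + _) * (2 * kap)]mulrDl.
have tot : G * S + G + (L / (q / B) * (23 * lg) * (2 * kap) + 7 * M / tau0 I * (2 * kap))
   <= q * F ^+ 2 * (2 * c + 120 * c * M) * (S + 1).
  have F2 : F <= F ^+ 2 by rewrite ler_eXnr.
  have g1 : G <= q * F ^+ 2 * (2 * c).
    rewrite (le_trans Gle) // (_ : q * F ^+ 2 * (2 * c) = q * (2 * c * F ^+ 2)); last by ring.
    by rewrite ler_pM2l // ler_pM2l // mulr_gt0 //; lra.
  have g2 : G * S <= q * F ^+ 2 * (2 * c) * S by rewrite ler_wpM2r.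
  have g3 : 0 <= q * F ^+ 2 * (120 * c * M) * S.
    apply: mulr_ge0 => //; apply: mulr_ge0.
      by apply: mulr_ge0; [exact: ltW | exact: sqr_ge0].
    by rewrite mulr_ge0 ?(ltW M0) //; lra.
  have -> : q * F ^+ 2 * (2 * c + 120 * c * M) * (S + 1)
   = q * F ^+ 2 * (2 * c) * S + q * F ^+ 2 * (2 * c)
     + (92 * c * M * q * F ^+ 2 + 28 * c * M * q * F ^+ 2)
     + q * F ^+ 2 * (120 * c * M) * S by ring.
  by rewrite ler_wpDr // lerD // lerD.
rewrite -mulrA.
have -> : 2 * (3 + 192 * c) * (2 * c + 120 * c * M) * F ^+ 5 * (d%:R * A * S + d%:R * A)
  = 2 * ((q * A * (3 + 192 * c) * F ^+ 3) * (q * F ^+ 2 * (2 * c + 120 * c * M) * (S + 1))).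
  by rewrite -qq; ring.
have k2 : 0 <= 2 * kap by rewrite mulr_ge0 // ltW.
have X0 : 0 <= L / (q / B) * (23 * lg) * (2 * kap).
  apply: mulr_ge0 => //; apply: mulr_ge0; last by rewrite mulr_ge0.
  by rewrite !divr_ge0 // ltW.
have Y0 : 0 <= 7 * M / tau0 I * (2 * kap).
  by apply: mulr_ge0 => //; rewrite divr_ge0 ?(ltW tuned_tau0_gt0) // mulr_ge0 // ltW.
have Z0 : 0 <= G * S + G by rewrite addr_ge0 // mulr_ge0.
by rewrite ler_pM2l // ler_pM // addr_ge0 // addr_ge0.
Qed.

End Tuning.

(** * Measurability of finite sums and of superlevel sets *)

Lemma measurable_sum_nat (R : realType) (disp : measure_display)
    (T' : measurableType disp) (m n : nat) (h : nat -> T' -> R) :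
  (forall s, (m <= s < n)%N -> measurable_fun [set: T'] (h s)) ->
  measurable_fun [set: T'] (fun w => \sum_(m <= s < n) h s w).
Proof.
move=> mh.
have -> : (fun w => \sum_(m <= s < n) h s w)
   = (fun w => \sum_(s <- index_iota m n) (if (m <= s < n)%N then h s w else 0)).
  by apply/funext => w; apply: eq_big_nat => s ->.
apply: measurable_sum => s; case: (boolP (m <= s < n)%N) => [|_]; first exact: mh.
exact: measurable_cst.
Qed.

Lemma measurable_ltr_set (R : realType) (disp : measure_display)
    (T' : measurableType disp) (X : T' -> R) (l : R) :
  measurable_fun [set: T'] X -> measurable [set w | (l < X w)%R].
Proof.
move=> mX; rewrite (_ : [set _ | _] = X @^-1` `]l, +oo[%classic); last first.
  by apply/seteqP; split => w /=; rewrite in_itv /= andbT.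
by rewrite -[X in measurable X]setTI; exact: mX.
Qed.

(** * Exponential supermartingales *)

Section SubSigmaAlgebra.
Variables (R : realType) (disp : measure_display) (Omega : measurableType disp).
Variable P : probability Omega R.
Implicit Types (G : set (set Omega)) (f u v Z : Omega -> R).

Lemma measurable_wrt_sub G1 G2 f : G1 `<=` G2 ->
  measurable_wrt G1 f -> measurable_wrt G2 f.
Proof. by move=> G12 mf _ Y mY; apply: (sub_sigma_algebra2 G12); exact: mf. Qed.

Lemma g_sigma_algebra_measurable G : G `<=` measurable -> <<s G>> `<=` measurable.
Proof. by move=> Gm; apply: smallest_sub => //; exact: sigma_algebra_measurable. Qed.

Lemma measurable_wrt_measurable G f : G `<=` measurable ->
  measurable_wrt G f -> measurable_fun [set: Omega] f.
Proof. by move=> Gm mf _ Y mY; apply: (g_sigma_algebra_measurable Gm); exact: mf. Qed.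

Lemma bounded_setT f (M : R) : (forall w, `|f w| <= M) ->
  [bounded f w | w in [set: Omega]].
Proof.
move=> fM; exists M; split; first exact: num_real.
by move=> r Mr w _; exact: le_trans (fM w) (ltW Mr).
Qed.

Lemma integrable_bounded f (M : R) : measurable_fun [set: Omega] f ->
  (forall w, `|f w| <= M) -> P.-integrable [set: Omega] (EFin \o f).
Proof.
move=> mf fM; apply: measurable_bounded_integrable => //.
  by rewrite (le_lt_trans (probability_le1 _ _)) ?ltry.
exact: bounded_setT fM.
Qed.

Import HBNNSimple.

(** Pull-out property: for a simple [Z] the claim is a finite combination of the hypothesis on its
    level sets, and simple functions measurable for [G] increase to [Z]. The integrals may be
    infinite throughout. *)
Lemma eq_integral_mul_wrt G u v Z : G `<=` measurable ->
  measurable_fun [set: Omega] u -> measurable_fun [set: Omega] v ->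
  (forall w, 0 <= u w) -> (forall w, 0 <= v w) ->
  (forall A, <<s G>> A -> (\int[P]_(w in A) (u w)%:E = \int[P]_(w in A) (v w)%:E)%E) ->
  measurable_wrt G Z -> (forall w, 0 <= Z w) ->
  (\int[P]_w (Z w * u w)%:E = \int[P]_w (Z w * v w)%:E)%E.
Proof.
move=> Gm mu_ mv u0 v0 uv mZ Z0; pose T' := g_sigma_algebraType G.
have mZ' : measurable_fun [set: T'] (EFin \o Z : T' -> \bar R).
  exact/measurable_EFinP.
pose f_ := nnsfun_approx measurableT mZ'.
have mf n : measurable_fun [set: Omega] (f_ n : Omega -> R).
  by apply: (measurable_wrt_measurable Gm); exact: measurable_funTS.
have key (g : {nnsfun T' >-> R}) (x : Omega -> R) :
    measurable_fun [set: Omega] x -> (forall w, 0 <= x w) ->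
  (\int[P]_w (g w * x w)%:E = \sum_(y \in range g)
      (y%:E * \int[P]_(w in g @^-1` [set y]) (x w)%:E))%E.
  move=> mx x0.
  have mA y : measurable (g @^-1` [set y] : set Omega).
    have mg : measurable (g @^-1` [set y] : set T') by exact: measurable_funPTI.
    exact: (g_sigma_algebra_measurable Gm mg).
  transitivity (\int[P]_w (\sum_(y \in range g)
      (y%:E * ((\1_(g @^-1` [set y]) w)%:E * (x w)%:E))))%E.
    apply: eq_integral => w _; rewrite EFinM fimfunE -fsumEFin // ge0_mule_fsuml.
      by apply: eq_fsbigr => y _; rewrite EFinM muleA.
    by move=> y; rewrite EFinM nnfun_muleindic_ge0.
  have mix y : measurable_fun [set: Omega]
      (fun w => ((\1_(g @^-1` [set y]) w)%:E * (x w)%:E)%E).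
    by apply: emeasurable_funM; apply/measurable_EFinP => //; exact: measurable_indic.
  have ix0 y w : (0 <= (\1_(g @^-1` [set y]) w)%:E * (x w)%:E)%E.
    by rewrite mule_ge0 // lee_fin.
  rewrite ge0_integral_fsum //=; last 2 first.
  - by move=> y; apply: emeasurable_funM => //.
  - by move=> y w _; rewrite muleA mule_ge0 ?nnfun_muleindic_ge0 ?lee_fin.
  apply: eq_fsbigr => y _; have [y0|y0] := ltP y 0.
    rewrite preimage_nnfun0 // integral_set0 mule0 integral0_eq // => w _.
    by rewrite indic0 mul0e mule0.
  rewrite ge0_integralZl //; congr (_ * _)%E.
  rewrite [RHS]integral_mkcond epatch_indic; apply: eq_integral => w _.
  by rewrite muleC.
have eqn n : (\int[P]_w (f_ n w * u w)%:E = \int[P]_w (f_ n w * v w)%:E)%E.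
  rewrite !key //; apply: eq_fsbigr => y _; congr (_ * _)%E; apply: uv.
  have mg : measurable (f_ n @^-1` [set y] : set T') by exact: measurable_funPTI.
  exact: mg.
have lim (x : Omega -> R) : measurable_fun [set: Omega] x -> (forall w, 0 <= x w) ->
    (\int[P]_w (Z w * x w)%:E = limn (fun n => \int[P]_w (f_ n w * x w)%:E))%E.
  move=> mx x0; rewrite -monotone_convergence //=.
  - apply: eq_integral => w _; apply/esym/cvg_lim => //=.
    have h : (EFin \o (f_ ^~ w)) n @[n --> \oo] --> (Z w)%:E.
      apply: (cvg_nnsfun_approx measurableT mZ') => // z _; by rewrite lee_fin.
    by have := cvgeZr (y := (x w)%:E) _ h; apply.
  - by move=> n; apply/measurable_EFinP/measurable_funM.
  - by move=> n w _; rewrite lee_fin mulr_ge0.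
  - move=> w _ m n mn; rewrite lee_fin ler_wpM2r //.
    by have /lefP := nd_nnsfun_approx measurableT mZ' mn; apply.
by rewrite !lim //; congr (limn _); apply/funext => n.
Qed.

(** The positive and negative parts of [f] have equal integrals on every set of the
    sub-sigma-algebra, and adding the constant [M] makes [Z] nonnegative; so the pull-out property
    applies, and the constant integrates to 0 against [f]. *)
Lemma integral_mul_centered G f Z (M : R) : G `<=` measurable ->
  P.-integrable [set: Omega] (EFin \o f) ->
  (forall A, <<s G>> A -> (\int[P]_(w in A) (f w)%:E = 0)%E) ->
  measurable_wrt G Z -> (forall w, `|Z w| <= M) ->
  (\int[P]_w (Z w * f w)%:E = 0)%E.
Proof.
move=> Gm intf f0 mZ ZM.
have mf : measurable_fun [set: Omega] f by apply/measurable_EFinP/(measurable_int _ intf).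
pose fp w := Num.max (f w) 0; pose fn w := Num.max (- f w) 0.
have mfp : measurable_fun [set: Omega] fp by apply: measurable_maxr.
have mfn : measurable_fun [set: Omega] fn.
  by apply: measurable_maxr => //; exact: measurableT_comp.
have fp0 w : 0 <= fp w by rewrite /fp le_max lexx orbT.
have fn0 w : 0 <= fn w by rewrite /fn le_max lexx orbT.
have fE w : f w = fp w - fn w.
  by rewrite /fp /fn; have [h|h] := leP (f w) 0; have [h'|h'] := leP (- f w) 0; lra.
have fple w : fp w <= `|f w| by rewrite /fp ge_max ler_norm normr_ge0.
have fnle w : fn w <= `|f w| by rewrite /fn ge_max normr_ge0 -normrN ler_norm.
have intp : P.-integrable [set: Omega] (EFin \o fp).
  apply: le_integrable intf => //; first exact/measurable_EFinP.
  by move=> w _ /=; rewrite lee_fin ger0_norm // fple.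
have intn : P.-integrable [set: Omega] (EFin \o fn).
  apply: le_integrable intf => //; first exact/measurable_EFinP.
  by move=> w _ /=; rewrite lee_fin (ger0_norm (fn0 w)) fnle.
have pn A : <<s G>> A -> (\int[P]_(w in A) (fp w)%:E = \int[P]_(w in A) (fn w)%:E)%E.
  move=> GA; have mA := g_sigma_algebra_measurable Gm GA.
  have ip : P.-integrable A (EFin \o fp) by apply: integrableS intp.
  have in_ : P.-integrable A (EFin \o fn) by apply: integrableS intn.
  have := f0 A GA; under eq_integral do rewrite fE EFinB.
  rewrite integralB //= => /eqP; rewrite sube_eq ?add0e; [by move/eqP| |].
    exact: integrable_fin_num.
  by rewrite fin_num_adde_defr.
pose Z1 w := Z w + M.
have Z10 w : 0 <= Z1 w by rewrite /Z1 -lerBlDr sub0r; have := ZM w; rewrite ler_norml => /andP[].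
have mZ1 : measurable_wrt G Z1 by apply: measurable_funD.
have Z1M w : `|Z1 w| <= M + M.
  have M0 : 0 <= M := le_trans (normr_ge0 _) (ZM w).
  by rewrite (le_trans (ler_normD _ _)) // lerD // ger0_norm.
have intZ (h : Omega -> R) (N : R) (k : Omega -> R) : measurable_wrt G h ->
    (forall w, `|h w| <= N) -> P.-integrable [set: Omega] (EFin \o k) ->
    P.-integrable [set: Omega] (fun w => (h w * k w)%:E).
  move=> mh hN ik; apply: (integrableMr measurableT _ (bounded_setT hN) ik).
  exact: measurable_wrt_measurable mh.
have e1 : (\int[P]_w (Z1 w * f w)%:E = 0)%E.
  under eq_integral do rewrite fE mulrBr EFinB.
  rewrite integralB //; [|exact: intZ Z1M intp|exact: intZ Z1M intn].
  rewrite (eq_integral_mul_wrt Gm mfp mfn) // subee //.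
  by apply: integrable_fin_num => //; exact: intZ Z1M intn.
have e2 : (\int[P]_w (M * f w)%:E = 0)%E.
  under eq_integral do rewrite EFinM.
  rewrite integralZl // f0 ?mule0 //.
  by have := @measurableT _ (g_sigma_algebraType G).
have -> : (\int[P]_w (Z w * f w)%:E = \int[P]_w ((Z1 w * f w)%:E - (M * f w)%:E))%E.
  by apply: eq_integral => w _; rewrite -EFinB -mulrBl /Z1 addrK.
rewrite integralB ?e1 ?e2 ?subee //; first exact: intZ Z1M intf.
by apply: (intZ (cst M) `|M| f _ _ intf) => //; exact: measurable_cst.
Qed.

(** Against the weight [Z] the centered term vanishes, b |f|^p may be replaced by b m <= q, and 1 +
    2 q <= exp (2 q). *)
Lemma exp_step G (f m Z Y a b q : Omega -> R) (p M : R) : G `<=` measurable ->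
  P.-integrable [set: Omega] (EFin \o f) ->
  (forall A, <<s G>> A -> (\int[P]_(w in A) (f w)%:E = 0)%E) ->
  measurable_wrt G m -> (forall w, 0 <= m w) ->
  (forall A, <<s G>> A ->
     (\int[P]_(w in A) (m w)%:E = \int[P]_(w in A) (`|f w| `^ p)%:E)%E) ->
  measurable_wrt G Z -> (forall w, 0 <= Z w <= M) ->
  measurable_wrt G a -> (forall w, `|a w| <= M) ->
  measurable_wrt G b -> (forall w, 0 <= b w) ->
  measurable_wrt G q -> (forall w, 0 <= q w <= M) ->
  (forall w, b w * m w <= q w) ->
  measurable_fun [set: Omega] Y ->
  (forall w, expR (Y w) <= 1 + a w * f w + 2 * (b w * `|f w| `^ p)) ->
  (\int[P]_w (Z w * expR (Y w))%:E <= \int[P]_w (Z w * expR (2 * q w))%:E)%E.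
Proof.
move=> Gm intf f0 mm m0 fm mZ ZM ma aM mb b0 mq qM bmq mY hY.
have Z0 w : 0 <= Z w by case/andP: (ZM w).
have q0 w : 0 <= q w by case/andP: (qM w).
have mf : measurable_fun [set: Omega] f by apply/measurable_EFinP/(measurable_int _ intf).
have mfp : measurable_fun [set: Omega] (fun w => `|f w| `^ p).
  by apply: (measurableT_comp (measurable_powR p)); exact: measurableT_comp.
have [oZ oa ob oq om] : [/\ measurable_fun setT Z, measurable_fun setT a,
    measurable_fun setT b, measurable_fun setT q & measurable_fun setT m].
  by split; apply: (measurable_wrt_measurable Gm).
have mZa : measurable_wrt G (fun w => Z w * a w) by apply: measurable_funM.
have Za w : `|Z w * a w| <= M * M.
  by rewrite normrM (ger0_norm (Z0 w)) ler_pM //; case/andP: (ZM w).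
have mZb : measurable_wrt G (fun w => Z w * b w) by apply: measurable_funM.
have Zb0 w : 0 <= Z w * b w by rewrite mulr_ge0.
have e1 := integral_mul_centered Gm intf f0 mZa Za.
have e2 : (\int[P]_w (Z w * b w * `|f w| `^ p)%:E = \int[P]_w (Z w * b w * m w)%:E)%E.
  by apply/esym/(eq_integral_mul_wrt Gm om mfp) => // w; exact: powR_ge0.
have intZ : P.-integrable [set: Omega] (EFin \o Z).
  by apply: (@integrable_bounded _ M) => // w; rewrite ger0_norm //; case/andP: (ZM w).
have intZq : P.-integrable [set: Omega] (EFin \o (fun w => Z w * q w)).
  apply: (@integrable_bounded _ (M * M)); first exact: measurable_funM.
  move=> w; rewrite ger0_norm ?mulr_ge0 // ler_pM //; first by case/andP: (ZM w).
  by case/andP: (qM w).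
have intZbm : P.-integrable [set: Omega] (EFin \o (fun w => Z w * b w * m w)).
  apply: le_integrable intZq => //.
    by apply/measurable_EFinP/measurable_funM => //; exact: measurable_funM.
  by move=> w _ /=; rewrite lee_fin !ger0_norm ?mulr_ge0 // -mulrA ler_wpM2l.
have intZf : P.-integrable [set: Omega] (EFin \o (fun w => Z w * a w * f w)).
  apply: (integrableMr measurableT _ (bounded_setT Za) intf); exact: measurable_funM.
(* |f|^p alone may have an infinite integral. Weighted by Z b, its integral is that of Z b m, which
   is at most the bounded Z q. *)
have intZfp : P.-integrable [set: Omega] (EFin \o (fun w => Z w * b w * `|f w| `^ p)).
  apply/integrableP; split.
    by apply/measurable_EFinP/measurable_funM => //; exact: measurable_funM.
  under eq_integral do rewrite /= ger0_norm ?mulr_ge0 ?powR_ge0 //.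
  by rewrite e2; exact: integrable_lty intZbm.
have i2 : P.-integrable [set: Omega] (fun w => (2%:E * (Z w * b w * `|f w| `^ p)%:E)%E).
  exact: integrableZl intZfp.
have i2q : P.-integrable [set: Omega] (fun w => (2%:E * (Z w * q w)%:E)%E).
  exact: integrableZl intZq.
apply: (@le_trans _ _ (\int[P]_w ((Z w)%:E + (Z w * a w * f w)%:E
    + 2%:E * (Z w * b w * `|f w| `^ p)%:E))%E).
  apply: ge0_le_integral => //=.
  - by move=> w _; rewrite lee_fin mulr_ge0 ?expR_ge0.
  - apply/measurable_EFinP/measurable_funM => //; exact: measurableT_comp.
  - apply: emeasurable_funD; last exact: measurable_int i2.
    by apply: emeasurable_funD; [exact: measurable_int intZ | exact: measurable_int intZf].
  - move=> w _; rewrite -EFinM -!EFinD lee_fin.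
    have h := ler_wpM2l (Z0 w) (hY w); apply: le_trans h _.
    by rewrite le_eqVlt; apply/orP; left; apply/eqP; ring.
rewrite integralD //; last exact: integrableD.
rewrite integralD // e1 adde0 integralZl // e2 -integralZl // -integralD //; last first.
  exact: integrableZl intZbm.
apply: ge0_le_integral => //=.
- by move=> w _; rewrite -EFinM -EFinD lee_fin addr_ge0 ?mulr_ge0.
- apply: emeasurable_funD; first exact: measurable_int intZ.
  by apply: measurable_int; exact: integrableZl intZbm.
- apply/measurable_EFinP/measurable_funM => //; apply: measurableT_comp => //.
  exact: measurable_funM.
- move=> w _; rewrite -EFinM -EFinD lee_fin.
  have h1 : Z w * (1 + 2 * q w) <= Z w * expR (2 * q w) by rewrite ler_wpM2l // expR_ge1Dx.
  have h2 := ler_wpM2l (Z0 w) (bmq w); apply: le_trans h1.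
  have -> : Z w * (1 + 2 * q w) = Z w + 2 * (Z w * q w) by ring.
  by rewrite lerD2l ler_pM2l // -mulrA.
Qed.

Lemma exp_supermartingale (G : nat -> set (set Omega)) (Y q : nat -> Omega -> R)
    (T : nat) (M : R) :
  0 <= M ->
  (forall s t, (s <= t)%N -> G s `<=` G t) ->
  (forall s, (1 <= s <= T)%N -> G s.-1 `<=` measurable) ->
  (forall s t, (1 <= s)%N -> (s <= t < T)%N -> measurable_wrt (G t) (Y s)) ->
  (forall s, (1 <= s <= T)%N -> measurable_wrt (G s.-1) (q s)) ->
  (forall s w, (1 <= s <= T)%N -> Y s w <= M) ->
  (forall s w, (1 <= s <= T)%N -> 0 <= q s w) ->
  (forall s Z N, (1 <= s <= T)%N -> measurable_wrt (G s.-1) Z ->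
     (forall w, 0 <= Z w <= N) ->
     (\int[P]_w (Z w * expR (Y s w))%:E <= \int[P]_w (Z w * expR (2 * q s w))%:E)%E) ->
  forall t, (t <= T)%N ->
    (\int[P]_w (expR (\sum_(1 <= s < t.+1) (Y s w - 2 * q s w)))%:E <= 1)%E.
Proof.
move=> M0 Gmono Gm mY mq YM q0 step; elim=> [_|t IH tT].
  under eq_integral do rewrite big_geq // expR0.
  by rewrite integral_cst // mul1e probability_le1.
have tI : (1 <= t.+1 <= T)%N by [].
(* The compensator of round [t.+1] is already known at time t, so it belongs to the weight, and
   [step] makes it cancel. *)
pose Z w := expR (\sum_(1 <= s < t.+1) (Y s w - 2 * q s w) - 2 * q t.+1 w).
have mZ : measurable_wrt (G t) Z.
  apply: measurableT_comp => //; apply: measurable_funB; last first.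
    by apply: measurable_funM => //; exact: (mq t.+1 tI).
  apply: measurable_sum_nat => s /andP[s1 st].
  have sT : (1 <= s <= T)%N by rewrite s1 (leq_trans _ (ltnW tT)).
  apply: measurable_funB; first by apply: mY; rewrite // -ltnS st.
  apply: measurable_funM => //; apply: (@measurable_wrt_sub (G s.-1)); last exact: mq.
  by apply: Gmono; rewrite (leq_trans (leq_pred _)).
have ZN w : 0 <= Z w <= expR (\sum_(1 <= s < t.+1) M).
  rewrite expR_ge0 ler_expR lerBlDr ler_wpDr ?mulr_ge0 ?q0 //.
  apply: ler_sum_nat => s /andP[s1 st].
  have sT : (1 <= s <= T)%N by rewrite s1 (leq_trans _ (ltnW tT)).
  by rewrite lerBlDr ler_wpDr ?mulr_ge0 ?q0 ?YM.
apply: le_trans (IH (ltnW tT)).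
have := step t.+1 Z _ tI mZ ZN; congr (_ <= _)%E; apply: eq_integral => w _; congr _%:E.
  by rewrite /Z -expRD [in RHS]big_nat_recr //=; congr (expR _); ring.
by rewrite /Z -expRD subrK.
Qed.

Lemma expR_markov (X : Omega -> R) (l : R) : measurable_fun [set: Omega] X ->
  (\int[P]_w (expR (X w))%:E <= 1)%E ->
  (P [set w | (l < X w)%R] <= (expR (- l))%:E)%E.
Proof.
move=> mX h; have mA := measurable_ltr_set l mX.
have e0 : 0 < expR (- l) by apply: expR_gt0.
have mE : measurable_fun [set: Omega] (fun w => (expR (X w))%:E).
  by apply/measurable_EFinP; exact: measurableT_comp.
have h1 : (\int[P]_(w in [set w | (l < X w)%R]) (expR l)%:E <= 1)%E.
  apply: le_trans h.
  apply: (@le_trans _ _ (\int[P]_(w in [set w | (l < X w)%R]) (expR (X w))%:E)%E).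
    apply: ge0_le_integral => //.
    - exact: measurable_funTS.
    - by move=> w /= lX; rewrite lee_fin ler_expR ltW.
  apply: ge0_subset_integral => // w _; by rewrite lee_fin expR_ge0.
rewrite -(@lee_pmul2l _ (expR l)%:E) ?lte_fin ?expR_gt0 // -EFinM -expRD subrr expR0.
by move: h1; rewrite integral_cst.
Qed.

End SubSigmaAlgebra.

(** * Measurability of the algorithm *)

Section MatrixMeasurability.
Variables (R : realType) (disp : measure_display) (T' : measurableType disp).

(** Squaring avoids the sign, and at 0 both sides vanish because the inverse of 0 is 0. *)
Lemma measurable_invr : measurable_fun [set: R] (GRing.inv : R -> R).
Proof.
have -> : (GRing.inv : R -> R) = (fun x => x * (x ^+ 2) `^ (-1)).
  apply/funext => x; rewrite powR_inv1 ?sqr_ge0 //.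
  have [->|x0] := eqVneq x 0; first by rewrite invr0 mul0r.
  by rewrite expr2 invfM mulrA mulfV ?mul1r.
apply: measurable_funM => //; apply: (measurableT_comp (measurable_powR (-1))).
exact: measurable_funX.
Qed.

Lemma measurable_sqrtr : measurable_fun [set: R] (@Num.sqrt R).
Proof.
have -> : (@Num.sqrt R) = (fun x => (Num.max x 0) `^ 2^-1).
  apply/funext => x; rewrite powR12_sqrt ?le_max ?lexx ?orbT //.
  have [x0|x0] := leP x 0; last by [].
  by rewrite sqrtr0 ler0_sqrtr.
apply: (measurableT_comp (measurable_powR 2^-1)); exact: measurable_maxr.
Qed.

Lemma measurable_clip : measurable_fun [set: R] (@clip R).
Proof. by apply: measurable_maxr => //; exact: measurable_minr. Qed.

Definition measurable_mx (m n : nat) (A : T' -> 'M[R]_(m, n)) : Prop :=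
  forall i j, measurable_fun [set: T'] (fun w => A w i j).

Lemma measurable_mx_cst m n (A : 'M[R]_(m, n)) : measurable_mx (fun=> A).
Proof. by move=> i j; exact: measurable_cst. Qed.

Lemma measurable_mxD m n (A B : T' -> 'M[R]_(m, n)) :
  measurable_mx A -> measurable_mx B -> measurable_mx (fun w => A w + B w).
Proof.
move=> mA mB i j; under eq_fun do rewrite mxE; exact: measurable_funD.
Qed.

Lemma measurable_mxZ m n (c : T' -> R) (A : T' -> 'M[R]_(m, n)) :
  measurable_fun [set: T'] c -> measurable_mx A -> measurable_mx (fun w => c w *: A w).
Proof.
move=> mc mA i j; under eq_fun do rewrite mxE; exact: measurable_funM.
Qed.

Lemma measurable_mx_tr m n (A : T' -> 'M[R]_(m, n)) :
  measurable_mx A -> measurable_mx (fun w => (A w)^T).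
Proof. by move=> mA i j; under eq_fun do rewrite mxE; exact: mA. Qed.

Lemma measurable_mxM m n p (A : T' -> 'M[R]_(m, n)) (B : T' -> 'M[R]_(n, p)) :
  measurable_mx A -> measurable_mx B -> measurable_mx (fun w => A w *m B w).
Proof.
move=> mA mB i j; under eq_fun do rewrite mxE.
by apply: measurable_sum => k; exact: measurable_funM.
Qed.

Lemma measurable_det n (A : T' -> 'M[R]_n) :
  measurable_mx A -> measurable_fun [set: T'] (fun w => \det (A w)).
Proof.
move=> mA; apply: measurable_sum => s; apply: measurable_funM => //.
by apply: measurable_prod => i _; exact: mA.
Qed.

(** Cramer's formula expresses the inverse through determinants. *)
Lemma measurable_mx_inv n (A : T' -> 'M[R]_n) : (forall w, A w \in unitmx) ->
  measurable_mx A -> measurable_mx (fun w => invmx (A w)).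
Proof.
move=> uA mA.
have -> : (fun w => invmx (A w)) = (fun w => (\det (A w))^-1 *: \adj (A w)).
  by apply/funext => w; rewrite /invmx uA.
apply: measurable_mxZ.
  by apply: (measurableT_comp measurable_invr); exact: measurable_det.
move=> i j; under eq_fun do rewrite mxE.
apply: measurable_funM => //; apply: measurable_det => k l.
by under eq_fun do rewrite !mxE; exact: mA.
Qed.

Lemma measurable_dot n (x y : T' -> 'cV[R]_n) :
  measurable_mx x -> measurable_mx y ->
  measurable_fun [set: T'] (fun w => dot (x w) (y w)).
Proof.
by move=> mx my; exact: (measurable_mxM (measurable_mx_tr mx) my 0 0).
Qed.

Lemma measurable_wnorm n (A : T' -> 'M[R]_n) (x : T' -> 'cV[R]_n) :
  measurable_mx A -> measurable_mx x ->
  measurable_fun [set: T'] (fun w => wnorm (A w) (x w)).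
Proof.
move=> mA mx; apply: (measurableT_comp measurable_sqrtr).
exact: (measurable_mxM (measurable_mxM (measurable_mx_tr mx) mA) mx 0 0).
Qed.

Variables (d : nat) (I : hoful_input R) (eps : R).
Variables (phi : nat -> T' -> 'cV[R]_d) (nu noise : nat -> T' -> R).
Hypotheses (lam0 : 0 < lambda I) (smin0 : 0 < sigma_min I).
(** Measurability is assumed only up to round [n], on an arbitrary space: the results then serve
    both for Omega, with [n] = T, and for the sigma-algebra of [history t], with [n] = [t.+1]. *)
Variable n : nat.
Hypothesis mphi : forall s, (1 <= s <= n)%N -> measurable_mx (phi s).
Hypothesis mnu : forall s, (1 <= s <= n)%N -> measurable_fun [set: T'] (nu s).

Let measurable_sigma_step s : (s < n)%N ->
  measurable_mx (fun w => Hmat I (phi ^~ w) (nu ^~ w) s) ->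
  measurable_fun [set: T'] (fun w => sigma I (phi ^~ w) (nu ^~ w) s.+1).
Proof.
move=> sn mH; have sI : (1 <= s.+1 <= n)%N by [].
have mw : measurable_fun [set: T']
    (fun w => wnorm (invmx (Hmat I (phi ^~ w) (nu ^~ w) s)) (phi s.+1 w)).
  apply: measurable_wnorm (mphi sI); apply: measurable_mx_inv => // w.
  exact/posdef_unit/Hmat_posdef.
apply: measurable_maxr; first exact: mnu.
apply: measurable_maxr; first exact: measurable_cst.
apply: measurable_maxr; first by apply: measurable_funM => //; exact: measurable_cst.
apply: measurable_funM; first exact: measurable_cst.
exact: (measurableT_comp measurable_sqrtr).
Qed.

Lemma measurable_Hmat t : (t <= n)%N ->
  measurable_mx (fun w => Hmat I (phi ^~ w) (nu ^~ w) t).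
Proof.
elim: t => [_|t IH tn]; first exact: measurable_mx_cst.
have tI : (1 <= t.+1 <= n)%N by [].
have mH := IH (ltnW tn); apply: measurable_mxD => //.
apply: measurable_mxZ; last exact/measurable_mxM/measurable_mx_tr/mphi/tI/mphi.
apply: (measurableT_comp measurable_invr); apply: measurable_funX.
exact: measurable_sigma_step.
Qed.

Lemma measurable_sigma s : (1 <= s <= n)%N ->
  measurable_fun [set: T'] (fun w => sigma I (phi ^~ w) (nu ^~ w) s).
Proof.
case: s => // s sn; apply: measurable_sigma_step => //.
exact/measurable_Hmat/ltnW.
Qed.

Lemma measurable_feature s : (1 <= s <= n)%N ->
  measurable_mx (fun w => feature I (phi ^~ w) (nu ^~ w) s).
Proof.
move=> sn; apply: measurable_mxZ; last exact: mphi.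
exact/(measurableT_comp measurable_invr)/measurable_sigma.
Qed.

Lemma measurable_invHmat t : (t <= n)%N ->
  measurable_mx (fun w => invmx (Hmat I (phi ^~ w) (nu ^~ w) t)).
Proof.
move=> tn; apply: measurable_mx_inv; last exact: measurable_Hmat.
by move=> w; exact/posdef_unit/Hmat_posdef.
Qed.

Lemma measurable_weight s : (1 <= s <= n)%N ->
  measurable_fun [set: T'] (fun w => weight I (phi ^~ w) (nu ^~ w) s).
Proof.
move=> sn; apply: measurable_wnorm; last exact: measurable_feature.
by apply: measurable_invHmat; case: s sn => // s /andP[_ /ltnW].
Qed.

Let measurable_sq1w s : (1 <= s <= n)%N -> measurable_fun [set: T']
  (fun w => Num.sqrt (1 + weight I (phi ^~ w) (nu ^~ w) s ^+ 2)).
Proof.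
move=> sn; apply: (measurableT_comp measurable_sqrtr).
apply: measurable_funD => //; apply: measurable_funX; exact: measurable_weight.
Qed.

Lemma measurable_inv_tau s : (1 <= s <= n)%N ->
  measurable_fun [set: T'] (fun w => inv_tau I eps (phi ^~ w) (nu ^~ w) s).
Proof.
move=> sn; apply: measurable_funM; last exact: measurable_cst.
apply: measurable_funM; first exact: measurable_weight.
exact/(measurableT_comp measurable_invr)/measurable_sq1w.
Qed.

Lemma measurable_score s : (1 <= s <= n)%N -> measurable_fun [set: T'] (noise s) ->
  measurable_fun [set: T'] (fun w => score I eps (phi ^~ w) (nu ^~ w) (noise ^~ w) s).
Proof.
move=> sn mn; apply: (measurableT_comp measurable_clip).
apply: measurable_funM; first exact: measurable_inv_tau.
apply: measurable_funM => //.
exact/(measurableT_comp measurable_invr)/measurable_sigma.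
Qed.

Lemma measurable_score_sum t : (t <= n)%N ->
  (forall s, (1 <= s <= t)%N -> measurable_fun [set: T'] (noise s)) ->
  measurable_mx (fun w => score_sum I eps (phi ^~ w) (nu ^~ w) (noise ^~ w) t).
Proof.
elim: t => [_ _|t IH tn mn].
  by move=> i j; under eq_fun do rewrite /score_sum big_geq // mxE; exact: measurable_cst.
have tI : (1 <= t.+1 <= n)%N by [].
rewrite /score_sum => i j; under eq_fun do rewrite big_nat_recr //=.
move: i j; apply: measurable_mxD.
  apply: IH => [|s /andP[s1 st]]; first exact: ltnW.
  by apply: mn; rewrite s1 ltnW.
apply: measurable_mxZ; last exact: measurable_feature.
apply: measurable_funM; first by apply: measurable_score => //; apply: mn; rewrite leqnn.
exact/(measurableT_comp measurable_invr)/measurable_inv_tau.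
Qed.

(** Only the noise of the rounds before s enters, which is what makes the coefficient
    predictable. *)
Lemma measurable_score_coef ell t s : (1 <= s <= n)%N ->
  (forall r, (1 <= r < s)%N -> measurable_fun [set: T'] (noise r)) ->
  measurable_fun [set: T']
    (fun w => score_coef I eps (phi ^~ w) (nu ^~ w) (noise ^~ w) ell t s).
Proof.
move=> sn mn; have sn' : (s.-1 <= n)%N by case: s sn {mn} => // s /andP[_ /ltnW].
apply: measurable_funM; first exact: measurable_cst.
apply: (measurableT_comp measurable_clip); apply: measurable_funM; last exact: measurable_cst.
apply: measurable_funM.
  apply: measurable_dot; first exact: measurable_feature.
  apply: measurable_mxM; first exact: measurable_invHmat.
  apply: measurable_score_sum => // r /andP[r1 rs]; apply: mn; rewrite r1 /=.
  by rewrite (leq_ltn_trans rs) // prednK //; case/andP: sn.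
apply: (measurableT_comp measurable_invr); apply: measurable_funM.
  exact: measurable_weight.
exact: measurable_sq1w.
Qed.

End MatrixMeasurability.

(** * Measurability with respect to the history *)

Section HistoryMeasurability.
Variables (R : realType) (d : nat) (disp : measure_display).
Variables (Omega : measurableType disp).
Variables (phi : nat -> Omega -> 'cV[R]_d) (rew : nat -> Omega -> R).

Lemma history_mono s t : (s <= t)%N -> history phi rew s `<=` history phi rew t.
Proof.
move=> st A [[r /= /andP[r1 rs] h]|[r /= /andP[r1 rs] h]]; [left|right]; exists r => //=.
  by rewrite r1 (leq_trans rs).
by rewrite r1 (leq_trans rs).
Qed.

(** The inequality t < T is strict because [history t] already contains the arm of round t + 1. *)
Lemma history_measurable (T t : nat) : (t < T)%N ->
  (forall s, (1 <= s <= T)%N -> forall i, measurable_fun [set: Omega] (fun w => phi s w i 0)) ->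
  (forall s, (1 <= s <= T)%N -> measurable_fun [set: Omega] (rew s)) ->
  history phi rew t `<=` measurable.
Proof.
move=> tT mphi mrew A [[r /= /andP[r1 rs] [i _ [B mB <-]]]|[r /= /andP[r1 rs] [B mB <-]]].
  by apply: mphi => //; rewrite r1 (leq_trans rs).
by apply: mrew => //; rewrite r1 (leq_trans rs) // ltnW.
Qed.

Lemma history_arm s t i : (1 <= s <= t.+1)%N ->
  measurable_wrt (history phi rew t) (fun w => phi s w i 0).
Proof.
move=> st _ Y mY; apply: sub_sigma_algebra; left; exists s => //.
by exists i => //; exists Y.
Qed.

End HistoryMeasurability.

(** * Concentration and conclusion *)

Section Concentration.
Variables (R : realType) (d T : nat) (L B eps delta : R).
Hypotheses (L0 : 0 < L) (B0 : 0 < B) (d0 : (0 < d)%N) (T0 : (0 < T)%N).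
Hypotheses (eps01 : 0 < eps <= 1) (delta01 : 0 < delta < 1).
Variables (D : nat -> set 'cV[R]_d) (theta_star : 'cV[R]_d).
Variables (disp : measure_display) (Omega : measurableType disp).
Variable P : probability Omega R.
Variables (phi : nat -> Omega -> 'cV[R]_d) (rew noise nu : nat -> Omega -> R).
Hypothesis env : heavy_tailed_bandit T L B eps D theta_star P phi rew noise nu.

Local Notation I := (tuned_input d T L B eps delta).
Local Notation lg := (ln (2 * T%:R ^+ 2 / delta)).
Local Notation rho s w := (inv_tau I eps (phi ^~ w) (nu ^~ w) s).
Local Notation sg s w := (sigma I (phi ^~ w) (nu ^~ w) s).
Local Notation coef t s w := (score_coef I eps (phi ^~ w) (nu ^~ w) (noise ^~ w) lg t s).
Local Notation scr s w := (score I eps (phi ^~ w) (nu ^~ w) (noise ^~ w) s).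
Local Notation hist := (history phi rew).

Let lam0 : 0 < lambda I. Proof. exact: tuned_lambda_gt0. Qed.
Let smin0 : 0 < sigma_min I. Proof. exact: tuned_sigma_min_gt0. Qed.
Let tau00 : 0 < tau0 I. Proof. exact: tuned_tau0_gt0. Qed.

Let hist_meas t : (t < T)%N -> hist t `<=` measurable.
Proof.
move=> tT; apply: (history_measurable tT).
  exact: (arm_measurable env).
exact: (reward_measurable env).
Qed.

Let noise_hist s t : (1 <= s <= T)%N -> (s <= t)%N -> measurable_wrt (hist t) (noise s).
Proof.
move=> sT st; apply: measurable_wrt_sub (noise_adapted env sT).
exact: history_mono.
Qed.

Let nu_hist s t : (1 <= s <= T)%N -> (s <= t.+1)%N -> measurable_wrt (hist t) (nu s).
Proof.
move=> sT st; apply: measurable_wrt_sub (nu_predictable env sT).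
apply: history_mono; by case: s sT st.
Qed.

Section Predictable.
Variable t : nat.
Hypothesis tT : (t < T)%N.
Let T' := g_sigma_algebraType (hist t).

Let mphi s : (1 <= s <= t.+1)%N -> @measurable_mx R _ T' _ _ (phi s).
Proof. by move=> st i j; rewrite ord1; exact: history_arm. Qed.

Let mnu s : (1 <= s <= t.+1)%N -> measurable_fun [set: T'] (nu s : T' -> R).
Proof.
move=> /andP[s1 st]; apply: nu_hist => //; by rewrite s1 (leq_trans st).
Qed.

Lemma inv_tau_predictable s : (1 <= s <= t.+1)%N ->
  measurable_wrt (hist t) (fun w => rho s w).
Proof. exact: (measurable_inv_tau eps lam0 mphi mnu). Qed.

Lemma sigma_predictable s : (1 <= s <= t.+1)%N ->
  measurable_wrt (hist t) (fun w => sg s w).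
Proof. exact: (measurable_sigma lam0 mphi mnu). Qed.

Lemma coef_predictable u s : (1 <= s <= t.+1)%N ->
  measurable_wrt (hist t) (fun w => coef u s w).
Proof.
move=> /andP[s1 st].
apply: (@measurable_score_coef _ _ T' _ _ _ _ _ noise lam0 t.+1 mphi mnu).
  by rewrite s1.
move=> r /andP[r1 rs]; have rt : (r <= t)%N by rewrite -ltnS (leq_trans rs).
by apply: noise_hist => //; rewrite r1 (leq_trans rt) // ltnW.
Qed.

Lemma score_adapted s : (1 <= s <= t)%N -> measurable_wrt (hist t) (fun w => scr s w).
Proof.
move=> /andP[s1 st].
apply: (@measurable_score _ _ T' _ _ _ _ _ noise lam0 t.+1 mphi mnu).
  by rewrite s1 leqW.
by apply: noise_hist => //; rewrite s1 (leq_trans st) // ltnW.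
Qed.

End Predictable.

Let mnoise s : (1 <= s <= T)%N -> measurable_fun [set: Omega] (noise s).
Proof.
move=> sT; have -> : noise s = (fun w => rew s w - dot (phi s w) theta_star).
  by apply/funext => w; rewrite (reward_eq env sT) addrC addKr.
apply: measurable_funB; first exact: (reward_measurable env).
apply: measurable_dot; last exact: measurable_mx_cst.
by move=> i j; rewrite ord1; exact: (arm_measurable env).
Qed.

Let mphiO s : (1 <= s <= T)%N -> @measurable_mx R _ Omega _ _ (phi s).
Proof. by move=> sT i j; rewrite ord1; exact: (arm_measurable env). Qed.

Let mnuO s : (1 <= s <= T)%N -> measurable_fun [set: Omega] (nu s).
Proof.
move=> sT; apply: (@measurable_wrt_measurable _ _ _ (hist s.-1)).
  by apply: hist_meas; case/andP: sT => s1; rewrite prednK.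
exact: (nu_predictable env).
Qed.

Let mscr s : (1 <= s <= T)%N -> measurable_fun [set: Omega] (fun w => scr s w).
Proof.
by move=> sT; apply: (measurable_score eps lam0 mphiO mnuO sT); exact: mnoise.
Qed.

Let mcoef u s : (1 <= s <= T)%N -> measurable_fun [set: Omega] (fun w => coef u s w).
Proof.
move=> sT; apply: (measurable_score_coef eps lam0 mphiO mnuO lg u sT).
move=> r /andP[r1 rs]; apply: mnoise; rewrite r1 /=.
by case/andP: sT => _; apply: leq_trans; exact: ltnW.
Qed.

(** In the second case of [is_cond_expectation] the noise is nonnegative; its integral over the
    whole space is then that of 0, hence finite. *)
Let noise_int s : (1 <= s <= T)%N -> P.-integrable [set: Omega] (EFin \o noise s).
Proof.
move=> sT; case: (noise_centered env sT) => [[//|[mn n0]] _ h].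
apply/integrableP; split; first exact/measurable_EFinP.
under eq_integral do rewrite /= ger0_norm //.
have := h setT; rewrite integral0 => <- //.
by have := @measurableT _ (g_sigma_algebraType (hist s.-1)).
Qed.

(** A deterministic bound, which provides the boundedness of the weights that [exp_step] asks
    for. *)
Lemma inv_tau_le_cst s w : (1 <= s)%N -> 0 <= rho s w <= (tau0 I)^-1.
Proof.
move=> s1; apply/andP; split; first exact: inv_tau_ge0.
rewrite /inv_tau.
set W := weight _ _ _ _.
have W0 : 0 <= W by apply: weight_ge0.
clearbody W.
have r1 : W <= Num.sqrt (1 + W ^+ 2).
  apply: sqr_le_imp; first exact: sqrtr_ge0.
  have h : 0 <= 1 + W ^+ 2 by rewrite addr_ge0 // sqr_ge0.
  by rewrite [leRHS]sqr_sqrtr // lerDr.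
have r0 : 0 < Num.sqrt (1 + W ^+ 2) by rewrite sqrtr_gt0 ltr_pwDl ?sqr_ge0.
have p1 : 1 <= (s%:R : R) `^ rate eps by have := pow_rate_mono eps01 s1; rewrite powR1.
have h1 : W / Num.sqrt (1 + W ^+ 2) <= 1 by rewrite ler_pdivrMr // mul1r.
have h2 : (tau0 I * s%:R `^ rate eps)^-1 <= (tau0 I)^-1.
  have p0 : 0 < (s%:R : R) `^ rate eps by exact: lt_le_trans ltr01 p1.
  rewrite lef_pV2 ?posrE //; last exact: mulr_gt0.
  by rewrite ler_peMr // ltW.
have h3 : 0 <= W / Num.sqrt (1 + W ^+ 2) by rewrite divr_ge0 // ltW.
have h4 : 0 <= (tau0 I * s%:R `^ rate eps)^-1 by rewrite invr_ge0 mulr_ge0 ?powR_ge0 // ltW.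
by apply: le_trans (ler_pM h3 h4 h1 h2) _; rewrite mul1r.
Qed.

Let p1eps : 1 <= 1 + eps <= 2.
Proof. by case/andP: eps01; lra. Qed.

(* Covers [Y = c * score] with [c] predictable, and [Y = score ^+ 2] with
   [c = 0]. *)
Lemma exp_tail (Y c : nat -> Omega -> R) (t : nat) : (t <= T)%N ->
  (forall s w, (1 <= s <= t)%N -> `|c s w| <= 1) ->
  (forall s, (1 <= s <= t)%N -> measurable_wrt (hist s.-1) (c s)) ->
  (forall s u, (1 <= s)%N -> (s <= u < t)%N -> measurable_wrt (hist u) (Y s)) ->
  (forall s, (1 <= s <= t)%N -> measurable_fun [set: Omega] (Y s)) ->
  (forall s w, (1 <= s <= t)%N -> Y s w <= 1) ->
  (forall s w, (1 <= s <= t)%N ->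
     expR (Y s w) <= 1 + c s w * (rho s w * (noise s w / sg s w))
        + 2 * `|rho s w * (noise s w / sg s w)| `^ (1 + eps)) ->
  (P [set w | (3 * lg < \sum_(1 <= s < t.+1) Y s w)%R] <= (expR (- lg))%:E)%E.
Proof.
move=> tT c1 mc mYh mY Y1 hY; pose q s w := rho s w `^ (1 + eps).
have sgp s w : 0 < sg s w by apply: sigma_gt0.
have q0 s w : 0 <= q s w by apply: powR_ge0.
have mq s u : (1 <= s <= u.+1)%N -> (u < T)%N -> measurable_wrt (hist u) (q s).
  move=> su uT; apply: (measurableT_comp (measurable_powR (1 + eps))).
  exact: inv_tau_predictable.
have tT' s : (1 <= s <= t)%N -> (1 <= s <= T)%N.
  by move=> /andP[-> st]; rewrite (leq_trans st).
have pT s : (1 <= s <= t)%N -> (s.-1 < T)%N.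
  by move/tT'/andP=> [s1 sT]; rewrite prednK.
have sm s w : sigma_min I <= sg s w by apply: sigma_ge_min.
have rsg s w : (1 <= s)%N -> 0 <= rho s w / sg s w <= (tau0 I)^-1 / sigma_min I.
  move=> s1; have /andP[r0 r1] := inv_tau_le_cst w s1.
  rewrite divr_ge0 ?(ltW (sgp _ _)) //= ler_pM ?invr_ge0 ?(ltW (sgp _ _)) //.
  by rewrite lef_pV2 ?posrE.
(* A common bound for all predictable weights; its value does not enter the tail. *)
pose K := (tau0 I)^-1 / sigma_min I + (tau0 I)^-1 `^ (1 + eps).
have K1 : (tau0 I)^-1 / sigma_min I <= K by rewrite lerDl powR_ge0.
have K2 : (tau0 I)^-1 `^ (1 + eps) <= K.
  by rewrite lerDr divr_ge0 ?invr_ge0 ?(ltW tau00) // ltW.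
have K0 : 0 <= K by rewrite (le_trans _ K2) // powR_ge0.
have e0 : 0 < 1 + eps by case/andP: eps01; lra.
have step s Z N : (1 <= s <= t)%N -> measurable_wrt (hist s.-1) Z ->
    (forall w, 0 <= Z w <= N) ->
    (\int[P]_w (Z w * expR (Y s w))%:E <= \int[P]_w (Z w * expR (2 * q s w))%:E)%E.
  move=> st mZ ZN; have sT := tT' _ st; have s1 : (1 <= s)%N by case/andP: st.
  have sp : (1 <= s <= s.-1.+1)%N by rewrite prednK // s1 leqnn.
  have [_ mm hm] := noise_moment env sT.
  have [_ _ hc] := noise_centered env sT.
  have mrho := inv_tau_predictable (pT _ st) sp.
  have mrs : measurable_wrt (hist s.-1) (fun w => rho s w / sg s w).
    apply: measurable_funM => //; apply: (measurableT_comp (@measurable_invr R)).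
    exact: (sigma_predictable (pT _ st) sp).
  apply: (@exp_step _ _ _ P (hist s.-1) (noise s) (fun w => nu s w `^ (1 + eps)) Z
    (Y s) (fun w => c s w * (rho s w / sg s w))
    (fun w => (rho s w / sg s w) `^ (1 + eps)) (q s) (1 + eps) (`|N| + K)).
  - exact: hist_meas (pT _ st).
  - exact: noise_int.
  - by move=> A hA; rewrite -hc // integral0.
  - exact: mm.
  - by move=> w; exact: powR_ge0.
  - exact: hm.
  - exact: mZ.
  - move=> w; have /andP[-> ZN'] := ZN w.
    by rewrite (le_trans ZN') // (le_trans (ler_norm _)) // lerDl.
  - by apply: measurable_funM => //; exact: mc.
  - move=> w; have /andP[r0 r1] := rsg s w s1.
    rewrite normrM (ger0_norm r0) (le_trans (ler_pM _ _ (c1 s w st) r1)) // mul1r.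
    by rewrite (le_trans K1) // lerDr.
  - exact: (measurableT_comp (measurable_powR (1 + eps)) mrs).
  - by move=> w; exact: powR_ge0.
  - exact: mq sp (pT _ st).
  - move=> w; rewrite q0 /= (le_trans (_ : _ <= K)) ?lerDr // (le_trans _ K2) //.
    have /andP[r0 r1] := inv_tau_le_cst w s1.
    by rewrite ge0_ler_powR ?nnegrE ?invr_ge0 ?(ltW e0) // ltW.
  - move=> w; have /andP[r0 _] := rsg s w s1.
    have /andP[i0 _] := inv_tau_le_cst w s1.
    have n0 := nu_ge0 env sT w.
    rewrite -powRM //; apply: ge0_ler_powR; rewrite ?nnegrE ?(ltW e0) //.
      exact: mulr_ge0.
    by rewrite mulrAC ler_pdivrMr // ler_wpM2l // sigma_ge_nu.
  - exact: mY.
  - move=> w; have /andP[r0 _] := rsg s w s1.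
    rewrite (le_trans (hY s w st)) // le_eqVlt; apply/orP; left; apply/eqP.
    congr (1 + _ + 2 * _); first by ring.
    rewrite -[rho s w * _](_ : rho s w / sg s w * noise s w = _); last by ring.
    by rewrite normrM (ger0_norm r0) (powRM _ r0 (normr_ge0 _)).
have h : (\int[P]_w (expR (\sum_(1 <= s < t.+1) (Y s w - 2 * q s w)))%:E <= 1)%E.
  apply: (exp_supermartingale (G := hist) (M := 1) ler01 _ _ mYh _ Y1 _ step (leqnn t)).
  - exact: history_mono.
  - by move=> s st; exact: hist_meas (pT _ st).
  - by move=> s st; apply: mq; [have /andP[s1 _] := st; rewrite prednK // s1 leqnn | exact: pT].
  - by move=> s w _; exact: q0.
have mX : measurable_fun [set: Omega] (fun w => \sum_(1 <= s < t.+1) (Y s w - 2 * q s w)).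
  apply: measurable_sum_nat => s st; apply: measurable_funB; first exact: mY.
  apply: measurable_funM => //; apply: (measurable_wrt_measurable (hist_meas (pT _ st))).
  by apply: mq; [have /andP[s1 _] := st; rewrite prednK // s1 leqnn | exact: pT].
have mYs : measurable_fun [set: Omega] (fun w => \sum_(1 <= s < t.+1) Y s w).
  by apply: measurable_sum_nat => s st; exact: mY.
apply: le_trans (expR_markov lg mX h).
apply: le_measure; rewrite ?inE; [exact: measurable_ltr_set|exact: measurable_ltr_set|].
(* The compensators 2 q_s sum to at most 2 [lg], so a sum above 3 [lg] leaves more than [lg] in the
   exponent of the supermartingale. *)
move=> w /= hw; rewrite big_split /= sumrN -mulr_sumr.
have phiL s : (1 <= s <= T)%N -> norm2 (phi s w) <= L.
  by move=> sT; apply: (arms_bounded env sT); exact: (arm_chosen env sT).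
have := tuned_sum_inv_tau L0 B0 d0 T0 eps01 delta01 (nu ^~ w) phiL.
have : \sum_(1 <= s < t.+1) q s w <= \sum_(1 <= s < T.+1) q s w.
  by rewrite [leRHS](big_cat_nat (n := t.+1)) //= lerDl sumr_ge0.
by rewrite /q; lra.
Qed.


Lemma expR_lg : expR (- lg) = delta / (2 * T%:R ^+ 2).
Proof.
have TR : 0 < T%:R :> R by rewrite ltr0n.
case/andP: delta01 => de0 _.
by rewrite expRN lnK ?invf_div // posrE divr_gt0 // mulr_gt0 // exprn_gt0.
Qed.

Definition good_event : set Omega :=
  [set w | (forall t, (1 <= t <= T)%N -> \sum_(1 <= s < t.+1) coef t s w * scr s w <= 3 * lg)
     /\ \sum_(1 <= s < T.+1) scr s w ^+ 2 <= 3 * lg].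

Let scr_le1 s w : -1 <= scr s w <= 1. Proof. exact: clip_bounds. Qed.

Lemma coef_tail t : (1 <= t <= T)%N ->
  (P [set w | (3 * lg < \sum_(1 <= s < t.+1) coef t s w * scr s w)%R]
     <= (expR (- lg))%:E)%E.
Proof.
move=> /andP[t1 tT].
have cb s w : (1 <= s <= t)%N -> -1 <= coef t s w <= 1 by move=> st; apply: score_coef_bounds.
have tT' s : (1 <= s <= t)%N -> (1 <= s <= T)%N.
  by move=> /andP[-> st]; rewrite (leq_trans st).
have pT s : (1 <= s <= t)%N -> (s.-1 < T)%N.
  by move/tT'/andP=> [s1 sT]; rewrite prednK.
apply: (exp_tail (Y := fun s w => coef t s w * scr s w) (c := fun s w => coef t s w) tT).
- by move=> s w st; rewrite ler_norml cb.
- move=> s st; apply: (coef_predictable (pT _ st)).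
  by have /andP[s1 _] := st; rewrite prednK // s1 leqnn.
- move=> s u s1 /andP[su ut]; have uT : (u < T)%N := leq_trans ut tT.
  apply: measurable_funM; first by apply: coef_predictable => //; rewrite s1 leqW.
  by apply: score_adapted => //; rewrite s1 su.
- by move=> s st; apply: measurable_funM; [apply: mcoef|apply: mscr]; exact: tT'.
- move=> s w st; have := cb s w st; have := scr_le1 s w; nra.
- by move=> s w st; exact: expR_clip_le (cb s w st) p1eps.
Qed.

Lemma score_tail :
  (P [set w | (3 * lg < \sum_(1 <= s < T.+1) scr s w ^+ 2)%R] <= (expR (- lg))%:E)%E.
Proof.
apply: (exp_tail (Y := fun s w => scr s w ^+ 2) (c := fun s w => 0) (leqnn T)).
- by move=> s w _; rewrite normr0.
- by move=> s _; exact: measurable_cst.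
- move=> s u s1 /andP[su uT]; apply: measurable_funX.
  by apply: score_adapted => //; rewrite s1 su.
- by move=> s st; apply: measurable_funX; exact: mscr.
- move=> s w st; have := scr_le1 s w; nra.
- by move=> s w st; rewrite mul0r addr0; exact: expR_clip2_le p1eps.
Qed.

Lemma good_event_prob :
  measurable good_event /\ ((1 - 3 * delta)%:E <= P good_event)%E.
Proof.
have TR : 1 <= T%:R :> R by rewrite ler1n.
have TR0 : 0 < T%:R :> R by rewrite ltr0n.
case/andP: delta01 => de0 de1.
(* Index i < T stands for round i + 1, and index T for the sum of squares. *)
pose F i := if (i < T)%N then
   [set w | (3 * lg < \sum_(1 <= s < i.+2) coef i.+1 s w * scr s w)%R]
  else [set w | (3 * lg < \sum_(1 <= s < T.+1) scr s w ^+ 2)%R].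
have mF i : measurable (F i).
  rewrite /F; case: ifP => iT; apply: measurable_ltr_set; apply: measurable_sum_nat => s st.
    have sT : (1 <= s <= T)%N by case/andP: st => -> si; rewrite (leq_trans _ iT).
    by apply: measurable_funM; [exact: mcoef|exact: mscr].
  by apply: measurable_funX; exact: mscr.
have mU : measurable (\big[setU/set0]_(i < T.+1) F i) by exact: bigsetU_measurable.
have gE : good_event = ~` (\big[setU/set0]_(i < T.+1) F i).
  apply/seteqP; split => w.
    move=> [h1 h2]; rewrite -bigcup_mkord => -[i /= iT]; rewrite /F; case: ifP => iT' /=.
      by rewrite ltNge h1.
    by rewrite ltNge h2.
  rewrite -bigcup_mkord => h; split.
    move=> [//|t] tT; rewrite leNgt; apply/negP => ht; apply: h; exists t => /=.
      by rewrite ltnW.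
    by rewrite /F ifT.
  by rewrite leNgt; apply/negP => ht; apply: h; exists T => //=; rewrite /F ltnn.
have PU : (P (\big[setU/set0]_(i < T.+1) F i) <= (3 * delta)%:E)%E.
  apply: (le_trans (Boole_inequality P (fun i _ => mF i))).
  apply: (@le_trans _ _ (\sum_(i < T.+1) (expR (- lg))%:E)%E).
    apply: lee_sum => i _; rewrite /F; case: ifP => iT; last exact: score_tail.
    by apply: coef_tail.
  (* The union bound gives (T + 1) delta / (2 T^2), which is at most 3 delta. *)
  rewrite sumEFin lee_fin sumr_const card_ord -[expR _ *+ _]mulr_natl expR_lg -[T.+1%:R]natr1.
  rewrite mulrA ler_pdivrMr ?mulr_gt0 ?exprn_gt0 //.
  have : delta * T%:R <= delta * T%:R ^+ 2 by rewrite ler_pM2l // ler_eXnr.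
  have : delta * 1 <= delta * T%:R ^+ 2 by rewrite ler_pM2l // exprn_ege1.
  have : 0 <= delta * T%:R ^+ 2 by rewrite mulr_ge0 ?sqr_ge0 // ltW.
  lra.
rewrite gE; split; first exact: measurableC.
rewrite probability_setC // EFinB leeB //.
Qed.

(** Needed because the good event is compared with this one through monotonicity of the measure. *)
Lemma measurable_regret_event (phi_star : nat -> 'cV[R]_d) (a b c : R) :
  measurable [set w | regret T theta_star phi_star (phi ^~ w) <=
    a * (b * Num.sqrt (\sum_(1 <= t < T.+1) nu t w ^+ 2) + c)].
Proof.
rewrite -[X in measurable X]setCK; apply: measurableC.
rewrite (_ : ~` _ = [set w | 0 < regret T theta_star phi_star (phi ^~ w) -
    a * (b * Num.sqrt (\sum_(1 <= t < T.+1) nu t w ^+ 2) + c)]); last first.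
  by apply/seteqP; split => w /=; rewrite subr_gt0 ltNge => /negP.
apply: measurable_ltr_set; apply: measurable_funB.
  apply: measurable_sum_nat => t tT; apply: measurable_funB; first exact: measurable_cst.
  by apply: measurable_dot; [exact: mphiO|exact: measurable_mx_cst].
apply: measurable_funM => //; apply: measurable_funD => //; apply: measurable_funM => //.
apply: (measurableT_comp (@measurable_sqrtr R)); apply: measurable_sum_nat => t tT.
by apply: measurable_funX; exact: mnuO.
Qed.

Lemma regret_on_good_event (phi_star : nat -> 'cV[R]_d) (theta : nat -> Omega -> 'cV[R]_d) w :
  (forall t, (1 <= t <= T)%N ->
     is_maximizer (D t) (fun x => dot x theta_star) (phi_star t)) ->
  heavy_oful_run eps I D (phi ^~ w) (rew ^~ w) (nu ^~ w) (theta ^~ w) ->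
  good_event w ->
  regret T theta_star phi_star (phi ^~ w) <=
   2 * (3 + 192 * (2 + (L * B) ^+ 2))
     * (2 * (2 + (L * B) ^+ 2) + 120 * (2 + (L * B) ^+ 2) * (L * B))
     * log_factor d T delta ^+ 5 *
    (d%:R * T%:R `^ rate eps * Num.sqrt (\sum_(1 <= t < T.+1) nu t w ^+ 2)
      + d%:R * T%:R `^ rate eps).
Proof.
move=> maxS run [gA gB].
have phiL s : (1 <= s <= T)%N -> norm2 (phi s w) <= L.
  by move=> sT; apply: (arms_bounded env sT); exact: (arm_chosen env sT).
have c00 : 0 < c0 I by apply: tuned_c0_gt0.
have c01 : c0 I <= 1 by apply: tuned_c0_le1.
have kap0 : 0 < kappa d I by apply: tuned_kappa_gt0.
have c10 : 0 < c1 I by apply: tuned_c1_gt0.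
have c1E : 48 * (c1 I * (2 * kappa d I)) = tau0 I ^+ 2 by apply: tuned_c1E.
have lgh : 1 / 2 <= lg by apply: lg_ge_half.
(* Role of the constant 23 in [c0]: 9/4 * 3 / 23 = 27/92 is below 1/3. *)
have hc : 9 / 4 * c0 I ^+ 2 * \sum_(1 <= s < T.+1) scr s w ^+ 2 <= 1 / 3.
  rewrite tuned_c0_sqr // invfM.
  have l0 : 0 < lg by lra.
  have := ler_wpM2l (_ : 0 <= 9 / 4 * (23^-1 * lg^-1)) gB.
  rewrite (_ : 9 / 4 * (23^-1 * lg^-1) * (3 * lg) = 27 / 92); last by field; rewrite gt_eqF.
  move=> /(_ _)/le_trans; apply; last by lra.
  by rewrite !mulr_ge0 // invr_ge0 ltW.
have conf t : (1 <= t <= T)%N ->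
    wnorm (Hmat I (phi ^~ w) (nu ^~ w) t) (theta t w - theta_star) <= beta I t.
  move=> tI; have /andP[t1 tT] := tI; rewrite tuned_betaE //.
  have [thB thmin] := huber_estimate run tI.
  apply: (confidence_bound (eps := eps) (noise := noise ^~ w) (rew := rew ^~ w)
    (T := T) (L := L) lam0 smin0 tau00 c00 tT) => //.
  - exact: ltW.
  - exact: ltW.
  - exact: (Defs.param_bounded env).
  - by move=> s sT; exact: (reward_eq env sT).
  - move=> s /andP[s1 sT].
    exact: (small_feature (phi ^~ w) (nu ^~ w) smin0 tau00 L0 B0 c10 kap0 c1E eps01 s1).
  - by apply: thmin; exact: (Defs.param_bounded env).
  - exact: (score_sum_bound lam0 tau00 eps01 lgh gA gB tT).
have bmono t : (1 <= t <= T)%N -> beta I t <= beta I T.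
  move=> /andP[t1 tT]; rewrite !tuned_betaE // lerD2l ler_pM2l //.
  rewrite ler_pM2r; last by lra.
  have t8 : 0 <= 8 * tau0 I by apply: mulr_ge0 => //; exact: ltW.
  by apply: ler_wpM2l => //; exact: pow_rate_mono.
have lb : Num.sqrt (lambda I) * param_bound I <= beta I T.
  rewrite tuned_betaE // [param_bound I]/=.
  have s0 : 0 <= Num.sqrt (lambda I) * B by rewrite mulr_ge0 ?sqrtr_ge0 // ltW.
  have : 0 <= 3 * (8 * tau0 I * T%:R `^ rate eps * lg).
    have t8 : 0 <= 8 * tau0 I by apply: mulr_ge0 => //; exact: ltW.
    apply: mulr_ge0 => //; apply: mulr_ge0; last by lra.
    exact: mulr_ge0 t8 (powR_ge0 _ _).
  by rewrite -mulrA; lra.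
have nphi := sum_nphi_le lam0 smin0 d0 c00 c01 tau00 L0 B0 c10 kap0 c1E phiL
  (fun s sT => nu_ge0 env sT w).
have := regret_le_sum lam0 (Defs.param_bounded env) maxS run lb bmono conf.
move=> /le_trans; apply.
apply: le_trans (tuned_regret_bound L0 B0 d0 T0 eps01 delta01 (sqrtr_ge0 _)).
rewrite ler_wpM2l // mulr_ge0 // (le_trans _ lb) // mulr_ge0 ?sqrtr_ge0 // ltW //.
Qed.

End Concentration.

Theorem theorem4p1 (R : realType) :
  exists k : nat, forall L B : R, 0 < L -> 0 < B ->
  exists2 C : R, 0 < C &
  forall (d T : nat) (eps delta : R),
    (0 < d)%N -> (0 < T)%N -> 0 < eps <= 1 -> 0 < delta < 1 ->
  forall (D : nat -> set 'cV[R]_d) (theta_star : 'cV[R]_d)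
    (phi_star : nat -> 'cV[R]_d)
    (disp : measure_display) (Omega : measurableType disp)
    (P : probability Omega R)
    (phi : nat -> Omega -> 'cV[R]_d) (rew noise nu : nat -> Omega -> R)
    (theta : nat -> Omega -> 'cV[R]_d),
    heavy_tailed_bandit T L B eps D theta_star P phi rew noise nu ->
    (forall t, (1 <= t <= T)%N ->
       is_maximizer (D t) (fun x => dot x theta_star) (phi_star t)) ->
    (forall w, heavy_oful_run eps (tuned_input d T L B eps delta) D
       (phi ^~ w) (rew ^~ w) (nu ^~ w) (theta ^~ w)) ->
  ((1 - 3 * delta)%:E <=
   P [set w | (regret T theta_star phi_star (phi ^~ w) <=
       C * log_factor d T delta ^+ k *
       (d%:R * T%:R `^ ((1 - eps) / (2 * (1 + eps)))
          * Num.sqrt (\sum_(1 <= t < T.+1) nu t w ^+ 2)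
        + d%:R * T%:R `^ ((1 - eps) / (2 * (1 + eps)))))%R])%E.
Proof.
exists 5%N => L B L0 B0; set c := 2 + (L * B) ^+ 2.
have c0 : 0 < c by rewrite ltr_pwDl // sqr_ge0.
have M0 : 0 < L * B by rewrite mulr_gt0.
exists (2 * (3 + 192 * c) * (2 * c + 120 * c * (L * B))).
  by rewrite !mulr_gt0 // addr_gt0 ?mulr_gt0.
move=> d T eps delta d0 T0 eps01 delta01 D theta_star phi_star disp Omega P.
move=> phi rew noise nu theta env maxS run.
have [mG PG] := good_event_prob L0 B0 d0 T0 eps01 delta01 env.
apply: le_trans PG _; apply: le_measure; rewrite ?inE //; last first.
  by move=> w /= gw; apply: (regret_on_good_event L0 B0 d0 T0 eps01 delta01 env maxS (run w) gw).
exact: (measurable_regret_event env).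
Qed.
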